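(* If all the ai-paths in a cycle-free atomic flow B are clean paths, then there exists an atomic flow C such that no ai-connections appear in C and B →_ex C.
   Context: Atomic flows are finite directed acyclic graphs whose vertices are labelled interaction (no upper edges, two lower edges), cointeraction or cut (two upper edges, no lower edges), weakening (one lower edge), coweakening (one upper edge), contraction (two upper edges, one lower edge) or cocontraction (one upper edge, two lower edges), together with dangling upper and lower edges, and which admit a polarity assignment. A path is a sequence of consecutive edges going only downwards (or its reverse). An ai-path is a concatenation of paths joined at interaction or cointeraction vertices (consecutive edges distinct); it is maximal if no longer ai-path contains its edges. An ai-connection is a path from an interaction vertex to a cointeraction vertex or vice versa; a simple edge is an ai-connection consisting of a single edge. A clean path is an ai-path in which every ai-connection is a simple edge. An ai-cycle is an ai-path from a vertex to itself with no repeated edge; a flow is cycle-free if it has no ai-cycles. If ε_1,…,ε_k,…,ε_h is a maximal clean path, ε_k is a simple edge and ε_{k+1},…,ε_h are not simple edges, then ε_k is an extremal simple edge. The reduction →_ex (''eliminate extremal simple edges'') is defined inductively. Base case: if B has no extremal simple edges, then B →_ex B. Inductive case: suppose B consists of a flow A with upper edges ε_1,…,ε_h and an additional upper edge 2, lower edges ε'_1,…,ε'_k and an additional lower edge 3, together with an interaction vertex whose two lower edges are 2 and 1, and a cointeraction vertex whose two upper edges are 3 and 1. Let B' be a copy Ã of A (edges renamed with tildes) in which the edge 2̃ is the lower edge of a new weakening vertex, and B'' a copy Â of A (edges renamed with hats) in which the edge 3̂ is the upper edge of a new coweakening vertex. If edge 1 is an extremal simple edge, B' →_ex D' and B'' →_ex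 D'', then B →_ex C, where C is formed from D' and D'' by identifying the lower edge 3̃ of D' with the upper edge 2̂ of D'', by attaching, for each i, a cocontraction vertex with upper edge ε_i and lower edges ε̃_i (into D') and ε̂_i (into D''), and, for each j, a contraction vertex with upper edges ε̃'_j (from D') and ε̂'_j (from D'') and lower edge ε'_j. *)

(* Defs.v *)
From HB Require Import structures.
From mathcomp Require Import all_boot.

Set Implicit Arguments.
Unset Strict Implicit.
Unset Printing Implicit Defensive.

Inductive kind :=
  | KInt
  | KCoint
  | KWeak
  | KCoweak
  | KContr
  | KCocontr.

Definition kind_eqb (a b : kind) : bool :=
  match a, b with
  | KInt, KInt | KCoint, KCoint | KWeak, KWeak | KCoweak, KCoweak
  | KContr, KContr | KCocontr, KCocontr => true
  | _, _ => false
  end.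

Lemma kind_eqP : Equality.axiom kind_eqb.
Proof. by case; case; constructor. Qed.

HB.instance Definition _ := hasDecEq.Build kind kind_eqP.

(* A vertex is (kind, upper edges, lower edges); edges are named by nat.
   "upper edges of v" = edges whose lower end is v (they lie above v). *)
Definition vertex := (kind * seq nat * seq nat)%type.
Definition vkind (v : vertex) : kind := v.1.1.
Definition vup (v : vertex) : seq nat := v.1.2.
Definition vlo (v : vertex) : seq nat := v.2.
Definition v0 : vertex := (KWeak, [::], [::]).

(* A flow: a list of edge names and a list of vertices (vertex ids are the
   positions in the list).  Edges not attached at some end are dangling. *)
Record flow := Flow { fedges : seq nat; fverts : seq vertex }.

Definition vat (F : flow) (v : nat) : vertex := nth v0 (fverts F) v.
Definition vkindF (F : flow) (v : nat) : kind := vkind (vat F v).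

Definition lo_at (F : flow) (e v : nat) : Prop :=
  v < size (fverts F) /\ e \in vup (vat F v).
Definition up_at (F : flow) (e v : nat) : Prop :=
  v < size (fverts F) /\ e \in vlo (vat F v).

Definition dang_up (F : flow) (e : nat) : bool :=
  ~~ has (fun v => e \in vlo v) (fverts F).
Definition dang_lo (F : flow) (e : nat) : bool :=
  ~~ has (fun v => e \in vup v) (fverts F).

Definition dpath (F : flow) (s : seq nat) : Prop :=
  s <> [::] /\ all (fun e => e \in fedges F) s /\
  forall i, i.+1 < size s ->
    exists v, lo_at F (nth 0 s i) v /\ up_at F (nth 0 s i.+1) v.

Definition arity_ok (v : vertex) : bool :=
  match vkind v with
  | KInt => (size (vup v) == 0) && (size (vlo v) == 2)
  | KCoint => (size (vup v) == 2) && (size (vlo v) == 0)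
  | KWeak => (size (vup v) == 0) && (size (vlo v) == 1)
  | KCoweak => (size (vup v) == 1) && (size (vlo v) == 0)
  | KContr => (size (vup v) == 2) && (size (vlo v) == 1)
  | KCocontr => (size (vup v) == 1) && (size (vlo v) == 2)
  end.

Definition polarity_ok (F : flow) (pol : nat -> bool) : Prop :=
  forall v, v \in fverts F ->
    match vkind v with
    | KInt => forall e f, e \in vlo v -> f \in vlo v -> e <> f -> pol e <> pol f
    | KCoint => forall e f, e \in vup v -> f \in vup v -> e <> f -> pol e <> pol f
    | KContr | KCocontr =>
        forall e f, e \in vup v ++ vlo v -> f \in vup v ++ vlo v -> pol e = pol f
    | KWeak | KCoweak => True
    end.

Definition atomic_flow (F : flow) : Prop :=
  uniq (fedges F) /\
  (forall v, v \in fverts F ->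
     arity_ok v /\ uniq (vup v ++ vlo v) /\ {subset vup v ++ vlo v <= fedges F}) /\
  (* each edge has at most one lower end and at most one upper end *)
  uniq (flatten (map vup (fverts F))) /\
  uniq (flatten (map vlo (fverts F))) /\
  (forall s, dpath F s -> forall v, ~ (up_at F (head 0 s) v /\ lo_at F (last 0 s) v)) /\
  (exists pol, polarity_ok F pol).

(* an edge traversed in a direction: true = downwards, false = upwards *)
Definition exitv (F : flow) (x : nat * bool) (v : nat) : Prop :=
  if x.2 then lo_at F x.1 v else up_at F x.1 v.
Definition entryv (F : flow) (x : nat * bool) (v : nat) : Prop :=
  if x.2 then up_at F x.1 v else lo_at F x.1 v.

Definition junction (F : flow) (x y : nat * bool) : Prop :=
  exists v, exitv F x v /\ entryv F y v /\
    (if x.2 == y.2 then True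
     else if x.2 then vkindF F v = KCoint /\ x.1 <> y.1
     else vkindF F v = KInt /\ x.1 <> y.1).

Definition aipath_dir (F : flow) (p : seq (nat * bool)) : Prop :=
  p <> [::] /\ all (fun x => x.1 \in fedges F) p /\
  forall i, i.+1 < size p -> junction F (nth (0, true) p i) (nth (0, true) p i.+1).

Definition ai_path (F : flow) (s : seq nat) : Prop :=
  exists ds : seq bool, size ds = size s /\ aipath_dir F (zip s ds).

Definition maximal_ai (F : flow) (s : seq nat) : Prop :=
  ai_path F s /\
  forall t, ai_path F t -> {subset s <= t} -> size t <= size s.

Definition conn_down (F : flow) (s : seq nat) : Prop :=
  dpath F s /\
  (exists v, up_at F (head 0 s) v /\ vkindF F v = KInt) /\
  (exists v, lo_at F (last 0 s) v /\ vkindF F v = KCoint).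

Definition ai_connection (F : flow) (s : seq nat) : Prop :=
  conn_down F s \/ conn_down F (rev s).

Definition simple_edge (F : flow) (e : nat) : Prop := ai_connection F [:: e].

Definition clean_path (F : flow) (s : seq nat) : Prop :=
  ai_path F s /\
  forall i j, i <= j -> j < size s -> ai_connection F (drop i (take j.+1 s)) -> i = j.

Definition ai_cycle (F : flow) (s : seq nat) : Prop :=
  exists ds : seq bool, size ds = size s /\ aipath_dir F (zip s ds) /\ uniq s /\
    exists v, entryv F (head (0, true) (zip s ds)) v /\
              exitv F (last (0, true) (zip s ds)) v.

Definition cycle_free (F : flow) : Prop := forall s, ~ ai_cycle F s.

Definition extremal (F : flow) (e : nat) : Prop :=
  exists s k, clean_path F s /\ maximal_ai F s /\ k < size s /\ nth 0 s k = e /\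
    simple_edge F e /\
    forall l, k < l -> l < size s -> ~ simple_edge F (nth 0 s l).

Definition no_ai_connection (F : flow) : Prop := forall s, ~ ai_connection F s.

Definition vnorm (v : vertex) : vertex :=
  (vkind v, sort leq (vup v), sort leq (vlo v)).
Definition flow_equiv (F G : flow) : Prop :=
  perm_eq (fedges F) (fedges G) /\
  perm_eq (map vnorm (fverts F)) (map vnorm (fverts G)).

Definition map_vertex (f : nat -> nat) (v : vertex) : vertex :=
  (vkind v, map f (vup v), map f (vlo v)).
Definition map_flow (f : nat -> nat) (A : flow) : flow :=
  Flow (map f (fedges A)) (map (map_vertex f) (fverts A)).

Definition add_ic (A : flow) (e1 e2 e3 : nat) : flow :=
  Flow (e1 :: fedges A)
       ((KInt, [::], [:: e2; e1]) :: (KCoint, [:: e3; e1], [::]) :: fverts A).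

Definition add_weak (A : flow) (e : nat) : flow :=
  Flow (fedges A) ((KWeak, [::], [:: e]) :: fverts A).
Definition add_coweak (A : flow) (e : nat) : flow :=
  Flow (fedges A) ((KCoweak, [:: e], [::]) :: fverts A).

Definition ups (A : flow) (e2 : nat) : seq nat :=
  [seq e <- fedges A | dang_up A e & e != e2].
Definition los (A : flow) (e3 : nat) : seq nat :=
  [seq e <- fedges A | dang_lo A e & e != e3].

(* the flow C built from D' (=D1) and D'' (=D2).  u1/l1 (resp. u2/l2) give
   the names in D1 (resp. D2) of the dangling upper/lower edges of B'
   (resp. B''); the glued edge (3~ of D1 = 2^ of D2) carries one name;
   U/L are the (fresh) names of the dangling upper/lower edges of C. *)
Definition glue (A : flow) (e2 e3 : nat) (t h : nat -> nat)
  (D1 : flow) (u1 l1 : nat -> nat) (D2 : flow) (u2 l2 : nat -> nat)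
  (U L : nat -> nat) : flow :=
  Flow (map U (ups A e2) ++ map L (los A e3) ++ fedges D1 ++
          [seq e <- fedges D2 | e != l1 (t e3)])
       (fverts D1 ++ fverts D2 ++
          [seq (KCocontr, [:: U e], [:: u1 (t e); u2 (h e)]) | e <- ups A e2] ++
          [seq (KContr, [:: l1 (t e); l2 (h e)], [:: L e]) | e <- los A e3]).

(* ex_rel B C U L : B ->_ex C, where U e / L e is the name in C of the
   dangling upper / lower edge e of B. *)
Inductive ex_rel : flow -> flow -> (nat -> nat) -> (nat -> nat) -> Prop :=
| ex_base (B : flow) :
    (forall e, ~ extremal B e) -> ex_rel B B id id
| ex_step (B A : flow) (e1 e2 e3 : nat) (t h : nat -> nat)
    (D1 : flow) (u1 l1 : nat -> nat) (D2 : flow) (u2 l2 : nat -> nat)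
    (U L : nat -> nat) :
    flow_equiv B (add_ic A e1 e2 e3) ->
    e1 \notin fedges A ->
    e2 \in fedges A -> dang_up A e2 ->
    e3 \in fedges A -> dang_lo A e3 ->
    e2 != e3 ->
    extremal B e1 ->
    {in fedges A &, injective t} ->
    {in fedges A &, injective h} ->
    ex_rel (add_weak (map_flow t A) (t e2)) D1 u1 l1 ->
    ex_rel (add_coweak (map_flow h A) (h e3)) D2 u2 l2 ->
    l1 (t e3) = u2 (h e2) ->
    (forall e, e \in fedges D1 -> e \in fedges D2 -> e = l1 (t e3)) ->
    {in ups A e2 &, injective U} ->
    {in los A e3 &, injective L} ->
    (forall e f, e \in ups A e2 -> f \in los A e3 -> U e != L f) ->
    (forall e, e \in ups A e2 -> U e \notin fedges D1 ++ fedges D2) ->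
    (forall e, e \in los A e3 -> L e \notin fedges D1 ++ fedges D2) ->
    ex_rel B (glue A e2 e3 t h D1 u1 l1 D2 u2 l2 U L) U L.

Definition ex_red (B C : flow) : Prop := exists U L, ex_rel B C U L.

(* Main.v *)
(** Resolving an extremal simple edge e1, whose partners are e2 at the
    interaction and e3 at the cointeraction, glues two smaller flows D' and D''
    along an edge g standing for e3 in D' and for e2 in D''.  An ai-connection
    across g would need an interaction above g in D' and a cointeraction below
    g in D''.  For a reduct D of B the following is invariant, for dangling
    edges e (upper) and f (lower):
    - if f lies below an interaction in D, then it does so in B;
    - if e lies above a cointeraction in D, then it does so in B;
    - if D has a path from e to f, then either B has one, or in B the edge e
      lies above a cointeraction and f below an interaction.
    So B would have an interaction above e3 and a cointeraction below e2.  But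
    all ai-connections of B are simple edges, so e3 and e2 would both be simple,
    whereas a maximal ai-path witnessing that e1 is extremal leaves e1 through
    e3 or through e2.  Edge names are kept disjoint by letting each reduct use,
    besides the names of B, only names above a prescribed bound. *)

Require Import Defs.
From mathcomp Require Import all_boot.
From Stdlib Require Import Classical.
From mathcomp Require Import zify.

Set Implicit Arguments.
Unset Strict Implicit.
Unset Printing Implicit Defensive.

(** * Steps between edges, reachability, and well-formed flows *)

Definition step (F : flow) : rel nat :=
  fun e f => has (fun V => (e \in vup V) && (f \in vlo V)) (fverts F).

Definition reach (F : flow) (e f : nat) : Prop :=
  exists2 s, path (step F) e s & last e s = f.

Definition int_edge (F : flow) (e : nat) : bool :=
  has (fun V => (vkind V == KInt) && (e \in vlo V)) (fverts F).
Definition coint_edge (F : flow) (e : nat) : bool :=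
  has (fun V => (vkind V == KCoint) && (e \in vup V)) (fverts F).

Definition from_int (F : flow) (f : nat) : Prop :=
  exists2 e, int_edge F e & reach F e f.
Definition to_coint (F : flow) (e : nat) : Prop :=
  exists2 f, coint_edge F f & reach F e f.
(** Only connections read downwards are recorded: one read upwards is the same list reversed. *)
Definition connected (F : flow) : Prop :=
  exists2 e, int_edge F e & to_coint F e.

Lemma reach_refl F e : reach F e e.
Proof. by exists [::]. Qed.

Lemma reach_stepl F e f g : step F e f -> reach F f g -> reach F e g.
Proof. by move=> ef [s ps ls]; exists (f :: s) => //=; rewrite ef. Qed.

(** The clauses of [atomic_flow] other than acyclicity and polarity. Those two pull back along
    morphisms, while these are checked directly on each flow that is built. *)
Definition wf_flow (F : flow) : Prop :=
  [/\ uniq (fedges F),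
      forall V, V \in fverts F ->
        arity_ok V /\ uniq (vup V ++ vlo V) /\
        {subset vup V ++ vlo V <= fedges F},
      uniq (flatten (map vup (fverts F))) &
      uniq (flatten (map vlo (fverts F)))].

Definition acyclic (F : flow) : Prop :=
  forall e f, step F e f -> ~ reach F f e.

(** Trades vertex positions for boolean tests on the list of vertices, so that all later arguments
    can avoid positions. *)
Lemma vertexP (F : flow) (P : pred vertex) :
  (exists v, v < size (fverts F) /\ P (vat F v)) <-> has P (fverts F).
Proof.
split; first by move=> [v [vs Pv]]; apply/(has_nthP v0); exists v.
by move/(has_nthP v0)=> [v vs Pv]; exists v.
Qed.

Lemma dpathP F s :
  dpath F s <->
  [/\ s != [::], all (fun e => e \in fedges F) s & sorted (step F) s].
Proof.
split.
  move=> [/eqP s0 [sF H]]; split=> //; apply/(sortedP 0)=> i /H [v [[vs e1] [_ e2]]].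
  by apply/vertexP; exists v; split=> //; apply/andP.
move=> [/eqP s0 sF /(sortedP 0) H]; split=> //; split=> // i /H /vertexP.
by move=> [v [vs /andP[e1 e2]]]; exists v.
Qed.

Lemma int_edge_mem F e : wf_flow F -> int_edge F e -> e \in fedges F.
Proof.
move=> [_ H _ _] /hasP[V VF /andP[_ eV]].
by case: (H V VF) => _ [_]; apply; rewrite mem_cat eV orbT.
Qed.

Lemma coint_edge_mem F e : wf_flow F -> coint_edge F e -> e \in fedges F.
Proof.
move=> [_ H _ _] /hasP[V VF /andP[_ eV]].
by case: (H V VF) => _ [_]; apply; rewrite mem_cat eV.
Qed.

Lemma step_mem F e f :
  wf_flow F -> step F e f -> e \in fedges F /\ f \in fedges F.
Proof.
move=> [_ H _ _] /hasP[V VF /andP[eV fV]].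
by case: (H V VF) => _ [_ S]; split; apply: S; rewrite mem_cat ?eV ?fV ?orbT.
Qed.

Lemma path_mem F e s :
  wf_flow F -> e \in fedges F -> path (step F) e s ->
  all (fun x => x \in fedges F) (e :: s).
Proof.
move=> wf; elim: s e => [|f s IH] e eF /=; first by rewrite eF.
move=> /andP[ef ps]; rewrite eF /=.
by have [_ fF] := step_mem wf ef; exact: IH.
Qed.

(** A cycle of steps passing through a vertex [v] amounts to a path that starts just below [v] and
    ends just above it. *)
Lemma atomic_flowP F :
  atomic_flow F <-> [/\ wf_flow F, acyclic F & exists pol, polarity_ok F pol].
Proof.
split.
  move=> [u [H [uu [ul [ac pol]]]]].
  have wf : wf_flow F by [].
  split=> // e f ef [s ps ls]; have [_ fF] := step_mem wf ef.
  move/vertexP: (ef) => [v [vs /andP[e1 e2]]].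
  apply: (ac (f :: s) _ v); last by split; split=> //=; rewrite ls.
  by apply/dpathP; split=> //; apply: path_mem ps.
move=> [[u H uu ul] ac pol]; split=> //; split=> //; split=> //; split=> //.
split=> // s /dpathP[s0 sF ss] v [[vs hv] [_ lv]].
case: s => // e s in s0 sF ss hv lv *.
apply: (ac (last e s) e); last by exists s.
by apply/vertexP; exists v; split=> //; apply/andP.
Qed.

Lemma conn_downP F s :
  conn_down F s <->
  [/\ dpath F s, int_edge F (head 0 s) & coint_edge F (last 0 s)].
Proof.
split.
  move=> [ds [[v [[vs iv] kv]] [w [[ws iw] kw]]]]; split=> //; apply/vertexP.
    by exists v; split=> //; rewrite iv andbT; apply/eqP.
  by exists w; split=> //; rewrite iw andbT; apply/eqP.
move=> [ds /vertexP[v [vs /andP[/eqP kv iv]]] /vertexP[w [ws /andP[/eqP kw iw]]]].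
by split=> //; split; [exists v | exists w].
Qed.

Lemma no_connectedP F : wf_flow F -> no_ai_connection F <-> ~ connected F.
Proof.
move=> wf; split.
  move=> H [e ie [f cf [s ps ls]]]; apply: (H (e :: s)); left.
  apply/conn_downP; split=> //=; last by rewrite ls.
  apply/dpathP; split=> //; exact: path_mem (int_edge_mem wf ie) ps.
have aux s : conn_down F s -> connected F.
  move=> /conn_downP[/dpathP[s0 sF ss] hs ls].
  case: s => // e s in s0 sF ss hs ls *.
  by exists e => //; exists (last e s) => //; exists s.
by move=> H s [] /aux.
Qed.

Lemma simple_edgeP F e : wf_flow F ->
  simple_edge F e <-> int_edge F e && coint_edge F e.
Proof.
move=> wf; split.
  by case=> /conn_downP[_ /= -> ->].
move=> /andP[ie ce]; left; apply/conn_downP; split=> //.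
by apply/dpathP; split=> //=; rewrite (int_edge_mem wf).
Qed.

(** * Directed ai-paths *)

(* [x.2] is true when the edge [x.1] is traversed downwards. *)
Definition exits (V : vertex) (x : nat * bool) : bool :=
  x.1 \in (if x.2 then vup V else vlo V).
Definition enters (V : vertex) (x : nat * bool) : bool :=
  x.1 \in (if x.2 then vlo V else vup V).
Definition joins (V : vertex) (x y : nat * bool) : bool :=
  [&& exits V x, enters V y &
    (x.2 == y.2) || (vkind V == (if x.2 then KCoint else KInt)) && (x.1 != y.1)].
Definition joined (F : flow) : rel (nat * bool) :=
  fun x y => has (fun V => joins V x y) (fverts F).

Lemma exitvP F x v :
  exitv F x v <-> v < size (fverts F) /\ exits (vat F v) x.
Proof. by case: x => e []. Qed.

Lemma entryvP F x v :
  entryv F x v <-> v < size (fverts F) /\ enters (vat F v) x.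
Proof. by case: x => e []. Qed.

Lemma junctionP F x y : junction F x y <-> joined F x y.
Proof.
rewrite /joined -vertexP; split=> [] [v].
  move=> [/exitvP[vs xv] [/entryvP[_ yv] H]]; exists v; split=> //.
  rewrite /joins xv yv /=; case: (x.2 == y.2) H => //=.
  by case: (x.2) => [] [/eqP H1 /eqP H2]; apply/andP.
move=> [vs /and3P[xv yv H]]; exists v; split; first exact/exitvP.
split; first exact/entryvP.
case: (x.2 == y.2) H => //=.
by case: (x.2) => /andP[/eqP H1 /eqP H2].
Qed.

Definition ai_dpath (F : flow) (p : seq (nat * bool)) : bool :=
  [&& p != [::], all (fun x => x.1 \in fedges F) p & sorted (joined F) p].

Lemma aipath_dirP F p : aipath_dir F p <-> ai_dpath F p.
Proof.
split.
  move=> [/eqP p0 [pF H]]; apply/and3P; split=> //.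
  by apply/(sortedP (0, true)) => i /H /junctionP.
move=> /and3P[/eqP p0 pF /(sortedP (0, true)) H]; split=> //; split=> //.
by move=> i /H /junctionP.
Qed.

Lemma ai_pathP F s : ai_path F s <-> exists2 p, ai_dpath F p & s = map fst p.
Proof.
split.
  by move=> [ds [sz /aipath_dirP H]]; exists (zip s ds); rewrite -/unzip1 ?unzip1_zip ?sz.
move=> [p Hp ->]; exists (map snd p); rewrite !size_map; split=> //.
by apply/aipath_dirP; rewrite -/unzip1 -/unzip2 zip_unzip.
Qed.

Definition ai_dcycle (F : flow) (p : seq (nat * bool)) : Prop :=
  [/\ ai_dpath F p, uniq (map fst p) &
      has (fun V => enters V (head (0, true) p) && exits V (last (0, true) p)) (fverts F)].

Lemma cycle_freeP F : cycle_free F <-> forall p, ~ ai_dcycle F p.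
Proof.
split=> H.
  move=> p [Hp up /vertexP[v [vs /andP[v1 v2]]]].
  apply: (H (map fst p)); exists (map snd p); rewrite !size_map; split=> //.
  rewrite -/unzip1 -/unzip2 zip_unzip; split; first exact/aipath_dirP.
  by split=> //; exists v; split; [apply/entryvP | apply/exitvP].
move=> s [ds [sz [/aipath_dirP Hp [us [v [/entryvP[vs v1] /exitvP[_ v2]]]]]]].
apply: (H (zip s ds)); split=> //; first by rewrite -/unzip1 unzip1_zip ?sz.
by apply/vertexP; exists v; split=> //; apply/andP.
Qed.

(** Applied to [vup] and [vlo]: an edge has at most one lower and at most one upper end. *)
Lemma uniq_flatten_inj (T U : eqType) (f : T -> seq U) (s : seq T) x y e :
  uniq (flatten (map f s)) -> x \in s -> y \in s -> e \in f x -> e \in f y -> x = y.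
Proof.
elim: s => //= z s IH; rewrite cat_uniq => /and3P[_ /hasPn nz us].
have out w : w \in s -> e \in f w -> e \in f z -> False.
  move=> ws ew ez; have /nz/negP : e \in flatten (map f s); last exact.
  by apply/flattenP; exists (f w) => //; apply: map_f.
rewrite !inE => /predU1P[->|xs] /predU1P[->|ys] // ex ey.
- by case: (out y).
- by case: (out x).
- exact: IH.
Qed.

Lemma exits_inj F V W x : wf_flow F ->
  V \in fverts F -> W \in fverts F -> exits V x -> exits W x -> V = W.
Proof.
by move=> [_ _ uu ul] VF WF; case: x => e []; rewrite /exits /=;
  [apply: uniq_flatten_inj uu _ _ | apply: uniq_flatten_inj ul _ _].
Qed.

(** A repeated edge would cut an ai-cycle out of the path. Hence ai-paths are no longer than the
    number of edges, which is what makes maximal ones exist. *)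
Lemma ai_dpath_uniq F p :
  wf_flow F -> cycle_free F -> ai_dpath F p -> uniq (map fst p).
Proof.
move=> wf /cycle_freeP cf; elim: p => // x [//|z p] IH /and3P[_ xpF xps].
have xF : x.1 \in fedges F by case/andP: xpF.
have pF : all (fun x => x.1 \in fedges F) (z :: p) by case/andP: xpF.
have Dp : ai_dpath F (z :: p).
  by apply/and3P; split=> //; case/andP: xps.
have up := IH Dp; rewrite map_cons cons_uniq up andbT.
apply/negP => /mapP[y yp exy].
have {xps} : path (joined F) x (z :: p) by [].
case/splitPr: yp up pF {Dp IH xpF} => p1 p2 up pF.
rewrite cat_path => /andP[ps1 /= /andP[lxy ps2]].
move: pF; rewrite all_cat => /andP[pF1 _].
move: up; rewrite map_cat cat_uniq => /and3P[up1 /norP[/= yp1 _] _].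
case: (eqVneq x.2 y.2) => [e2|ne2].
  have exy' : x = y by move: exy e2; case: (x) (y) => a b [c d] /= -> ->.
  (* Same direction: the stretch from [x] to the edge before [y] closes up at the vertex where [x]
     starts. *)
  apply: (cf (x :: p1)); split.
  - by apply/and3P; split=> //=; rewrite xF.
  - by rewrite /= up1 exy yp1.
  move: lxy => /hasP[V VF /and3P[ex en _]]; apply/hasP; exists V => //=.
  by rewrite exy' in ex en *; rewrite ex en.
have ey V : enters V y = exits V x.
  by rewrite /enters /exits exy; case: (x.2) (y.2) ne2 => [] [].
(* Opposite directions: [y] starts where [x] ends. With nothing in between, the path would turn back
   along one edge, which [joins] forbids. *)
case: p1 ps1 lxy pF1 up1 yp1 => [|w p1] /=.
  move=> _ /hasP[V VF /and3P[_ _]].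
  by rewrite (negbTE ne2) exy eqxx andbF.
move=> /andP[/hasP[V VF /and3P[xV wV _]] ps1] /hasP[W WF /and3P[lW yW _]] pF1 up1 _.
(* The stretch strictly between [x] and [y] starts and ends at the lower or upper end [V] where [x]
   ends. *)
apply: (cf (w :: p1)); split=> //; first by apply/and3P.
apply/hasP; exists V => //=; rewrite wV /=.
by rewrite (exits_inj wf VF WF xV) // -ey.
Qed.

(** Prolong [s] while possible; the number of edges of [F] bounds the length of every ai-path. *)
Lemma maximal_ai_exists F s : wf_flow F -> cycle_free F -> ai_path F s ->
  exists2 t, {subset s <= t} & maximal_ai F t.
Proof.
move=> wf cf; have [n] := ubnP (size (fedges F) - size s).
elim: n s => // n IH s sn As.
case: (classic (maximal_ai F s)) => [ms|nm]; first by exists s.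
have [t [At st szt]] : exists t, [/\ ai_path F t, {subset s <= t} & size s < size t].
  apply: NNPP => H; apply: nm; split=> // t At st; rewrite leqNgt; apply/negP=> lt.
  by apply: H; exists t.
have tF : size t <= size (fedges F).
  move/ai_pathP: At => [p Dp ->]; apply: uniq_leq_size; first exact: ai_dpath_uniq Dp.
  by move=> _ /mapP[x xp ->]; case/and3P: Dp => _ /allP/(_ x xp).
have [|u tu mu] := IH t _ At; first by lia.
by exists u => // x /st /tu.
Qed.

(** * Clean flows and extremal simple edges *)

Definition all_clean (F : flow) : Prop := forall s, ai_path F s -> clean_path F s.

(** The downward path from [e] to [f] is an ai-path which as a whole is an ai-connection; cleanness,
    applied to its first and last positions, leaves a single edge. *)
Lemma connection_simple F e f : wf_flow F -> all_clean F ->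
  int_edge F e -> reach F e f -> coint_edge F f -> e = f.
Proof.
move=> wf cl ie [s ps ls] cf.
have sF := path_mem wf (int_edge_mem wf ie) ps.
have As : ai_path F (e :: s).
  apply/ai_pathP; exists [seq (x, true) | x <- e :: s].
    apply/and3P; split=> //; first by rewrite all_map.
    rewrite sorted_map /=; apply: sub_path ps => x y /hasP[V VF xy].
    by apply/hasP; exists V; rewrite // /joins /exits /enters /= andbT.
  by rewrite -map_comp map_id.
have [_ /(_ 0 (size s)) H] := cl _ As.
suff s0 : s = [::] by rewrite -ls s0.
apply/size0nil; rewrite -H // drop0 -/(size (e :: s)) take_size; left.
by apply/conn_downP; split=> //=; [apply/dpathP | rewrite ls].
Qed.

(** On a maximal ai-path through [e], which is clean by assumption, the last simple edge is
    extremal. *)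
Lemma extremal_exists F e : wf_flow F -> cycle_free F -> all_clean F ->
  simple_edge F e -> exists f, extremal F f.
Proof.
move=> wf cf cl /(simple_edgeP _ wf) se.
have As : ai_path F [:: e].
  apply/ai_pathP; exists [:: (e, true)] => //.
  by apply/and3P; split=> //=; case/andP: se => /(int_edge_mem wf) ->.
have [t et mt] := maximal_ai_exists wf cf As.
pose P k := (k < size t) && (int_edge F (nth 0 t k) && coint_edge F (nth 0 t k)).
have exP : exists k, P k.
  have et' : e \in t by apply: et; rewrite inE.
  by exists (index e t); rewrite /P index_mem et' nth_index.
have ubP k : P k -> k <= size t by case/andP=> /ltnW.
have [k /andP[kt sk] maxk] := ex_maxnP exP ubP.
exists (nth 0 t k), t, k; split; first by apply: cl; case: mt.
split=> //; split=> //; split=> //; split; first exact/simple_edgeP.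
move=> l kl lt /(simple_edgeP _ wf) sl.
by have := maxk l; rewrite /P lt sl => /(_ isT); lia.
Qed.

(* A maximal path through [e] continues at the (co)interaction where it leaves
   [e], necessarily along the other edge of that vertex. *)
Lemma extremal_next F e : wf_flow F -> extremal F e ->
  exists b, forall V f, V \in fverts F -> vkind V = (if b then KCoint else KInt) ->
    exits V (e, b) -> exits V (f, b) -> f <> e -> ~ simple_edge F f.
Proof.
move=> wf [s [k [_ [[/ai_pathP[p Dp sp] mx] [ks [nk [_ ex]]]]]]].
have kp : k < size p by rewrite sp size_map in ks.
pose x := nth (0, true) p k.
have xe : x.1 = e by rewrite /x -(nth_map _ 0) // -sp nk.
have xb : x = (e, x.2) by rewrite -xe; case: (x).
(* The direction is the one in which the witnessing path traverses [e]. *)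
exists (x.2) => V f VF kV; rewrite -xb => xV fV fe.
have [arV [_ sV]] : arity_ok V /\ uniq (vup V ++ vlo V) /\
  {subset vup V ++ vlo V <= fedges F} by case: wf => _ /(_ V VF).
have enf y : y.2 = ~~ x.2 -> enters V y = exits V (y.1, x.2).
  by rewrite /enters /exits /= => ->; case: (x.2).
case: (ltnP k.+1 (size p)) => [k1p|pk].
  (* If the path goes on after [e], its next edge is not simple, so it is enough that [f] is that
     edge. *)
  suff -> : f = nth 0 s k.+1 by apply: ex => //; rewrite sp size_map.
  rewrite sp (nth_map (0, true)) //; set y := nth _ p k.+1.
  have /hasP[W WF /and3P[xW yW dir]] : joined F x y.
    by case/and3P: Dp => _ _ /(sortedP (0, true)); apply.
  have eWV := exits_inj wf WF VF xW xV.
  move: yW dir; rewrite {W WF xW}eWV; case: eqVneq => [e2|n2] /=.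
    (* Going on in the same direction would need an edge on the side of [V] where an interaction or
       a cointeraction has none. *)
    rewrite /enters -e2; move: arV; rewrite /arity_ok kV.
    by by case: (x.2) => /andP[/eqP s1 /eqP s2]; rewrite ?(size0nil s1) ?(size0nil s2).
  rewrite (enf y); last by move: n2; case: (x.2) (y.2) => [] [].
  (* [V] has exactly two edges; [f] and the next edge both differ from [e], so they coincide. *)
  move=> yV /andP[_ /eqP]; rewrite xe => ye.
  move: arV xV fV yV; rewrite /arity_ok /exits kV xe /= => arV.
  case: (x.2) arV => /andP[].
    case: (vup V) => [|a [|b []]] //= _ _.
    rewrite !inE => /orP[]/eqP h1 /orP[]/eqP h2 /orP[]/eqP h3; congruence.
  case: (vlo V) => [|a [|b []]] //= _ _.
  rewrite !inE => /orP[]/eqP h1 /orP[]/eqP h2 /orP[]/eqP h3; congruence.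
(* Otherwise [e] ends the path, and turning back along [f] at [V] would prolong it, against
   maximality. *)
have : size (rcons s f) <= size s.
  apply: mx; last by move=> z; rewrite mem_rcons inE orbC => ->.
  apply/ai_pathP; exists (rcons p (f, ~~ x.2)); last by rewrite map_rcons -sp.
  case/and3P: Dp => p0 pF ps; apply/and3P; split; first by case: (p).
    rewrite all_rcons pF andbT; apply: sV; move: fV.
    by rewrite mem_cat /exits /=; case: (x.2) => ->; rewrite ?orbT.
  case: p p0 ps @x kp xe xb VF kV xV fV enf pk {pF sp} => // z p _ ps x kp xe xb VF kV xV fV enf pk.
  rewrite /= rcons_path; move: ps => /= ->.
  apply/hasP; exists V => //; rewrite /joins.
  have -> : last z p = x by rewrite (last_nth (0, true)) /x; congr nth;
    move: pk kp => /=; lia.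
  rewrite xV enf //= fV kV eqxx xe /=.
  by rewrite orbC; move: fe => /eqP; rewrite eq_sym => ->.
by rewrite size_rcons ltnn.
Qed.

(** Since [e3] meets a cointeraction, an interaction above it makes it simple by
    [connection_simple]; dually for [e2]. But [extremal_next] says that one of the two is not
    simple. *)
Lemma extremal_separates F V1 V2 e1 e2 e3 : wf_flow F -> all_clean F ->
  V1 \in fverts F -> vkind V1 = KInt -> e1 \in vlo V1 -> e2 \in vlo V1 -> e2 <> e1 ->
  V2 \in fverts F -> vkind V2 = KCoint -> e1 \in vup V2 -> e3 \in vup V2 -> e3 <> e1 ->
  extremal F e1 -> from_int F e3 -> to_coint F e2 -> False.
Proof.
move=> wf cl V1F k1 e11 e21 n21 V2F k2 e12 e32 n31 ex [e ie re3] [f cf r2f].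
have i2 : int_edge F e2 by apply/hasP; exists V1 => //; rewrite k1 e21.
have c3 : coint_edge F e3 by apply/hasP; exists V2 => //; rewrite k2 e32.
have [[] /= H] := extremal_next wf ex.
  apply: (H V2 e3) => //; apply/simple_edgeP => //.
  by rewrite c3 andbT -(connection_simple wf cl ie re3 c3).
apply: (H V1 e2) => //; apply/simple_edgeP => //.
by rewrite i2 (connection_simple wf cl i2 r2f cf).
Qed.

(** * Flow morphisms *)

(* A vertex may be mapped to one of another kind only if it is a weakening or
   a coweakening. *)
Definition flow_morph (g : nat -> nat) (F G : flow) : Prop :=
  [/\ {in fedges F &, injective g},
      forall e, e \in fedges F -> g e \in fedges G &
      forall V, V \in fverts F -> exists W,
        [/\ W \in fverts G,
            forall e, e \in vup V -> g e \in vup W,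
            forall e, e \in vlo V -> g e \in vlo W &
            vkind V \in [:: KWeak; KCoweak] \/ vkind V = vkind W]].

Section Morphism.
Variables (g : nat -> nat) (F G : flow).
Hypotheses (wfF : wf_flow F) (gm : flow_morph g F G).

Lemma morph_step e f : step F e f -> step G (g e) (g f).
Proof.
case: gm => _ _ H /hasP[V /H [W [WG hu hl _]] /andP[eV fV]].
by apply/hasP; exists W => //; rewrite hu ?hl.
Qed.

Lemma morph_reach e f : reach F e f -> reach G (g e) (g f).
Proof.
move=> [s ps <-]; exists (map g s); last by rewrite last_map.
by rewrite path_map; apply: sub_path ps => x y; apply: morph_step.
Qed.

Lemma morph_int e : int_edge F e -> int_edge G (g e).
Proof.
case: gm => _ _ H /hasP[V /H [W [WG hu hl]] kW /andP[/eqP kV eV]].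
by apply/hasP; exists W => //; move: kW; rewrite kV hl // => -[//|<-].
Qed.

Lemma morph_coint e : coint_edge F e -> coint_edge G (g e).
Proof.
case: gm => _ _ H /hasP[V /H [W [WG hu hl]] kW /andP[/eqP kV eV]].
by apply/hasP; exists W => //; move: kW; rewrite kV hu // => -[//|<-].
Qed.

Lemma morph_from_int e : from_int F e -> from_int G (g e).
Proof. by move=> [f /morph_int i /morph_reach r]; exists (g f). Qed.

Lemma morph_to_coint e : to_coint F e -> to_coint G (g e).
Proof. by move=> [f /morph_coint i /morph_reach r]; exists (g f). Qed.

(** Paths push forward, so properties that forbid paths pull back. This and the next lemmas carry
    the hypotheses on a flow over to its two smaller copies. *)
Lemma morph_acyclic : acyclic G -> acyclic F.
Proof. by move=> H e f /morph_step ef /morph_reach; apply: H. Qed.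

(** Injectivity matters at interactions and cointeractions, where distinct edges must keep distinct
    images; weakenings and coweakenings impose no condition on polarities. *)
Lemma morph_polarity pol : polarity_ok G pol -> polarity_ok F (pol \o g).
Proof.
case: gm => gi _ H PG V VF; have [W [WG hu hl kW]] := H V VF.
have sV e : e \in vup V ++ vlo V -> e \in fedges F.
  by case: wfF => _ /(_ V VF) [_ [_ sV]] _ _; apply: sV.
have gup e f : e \in vup V ++ vlo V -> f \in vup V ++ vlo V -> e <> f -> g e <> g f.
  by move=> /sV eF /sV fF ef /(gi _ _ eF fF).
have hul e : e \in vup V ++ vlo V -> g e \in vup W ++ vlo W.
  by rewrite !mem_cat => /orP[/hu|/hl] ->; rewrite ?orbT.
move: kW (PG W WG); case kV: (vkind V) => //= -[//|<-] PW.
- move=> e f eV fV ef; apply: PW; [exact: hl | exact: hl |].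
  by apply: gup; rewrite ?mem_cat ?eV ?fV ?orbT.
- move=> e f eV fV ef; apply: PW; [exact: hu | exact: hu |].
  by apply: gup; rewrite ?mem_cat ?eV ?fV ?orbT.
- by move=> e f /hul eV /hul fV; apply: PW.
- by move=> e f /hul eV /hul fV; apply: PW.
Qed.

Definition dmap (x : nat * bool) := (g x.1, x.2).

Lemma fst_dmap p : map fst (map dmap p) = map g (map fst p).
Proof. by rewrite -!map_comp. Qed.

Lemma morph_ai_dpath p : ai_dpath F p -> ai_dpath G (map dmap p).
Proof.
case: gm => gi gF H /and3P[p0 pF ps]; apply/and3P; split.
- by case: (p) p0.
- by rewrite all_map; apply: sub_all pF => x /gF.
rewrite sorted_map; apply: sub_in_sorted ps; last exact: pF.
move=> x y xF yF /hasP[V /H[W [WG hu hl kW]] /and3P[xV yV dir]].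
apply/hasP; exists W => //; apply/and3P; split=> /=.
- by move: xV; rewrite /exits /=; case: (x.2) => [/hu|/hl].
- by move: yV; rewrite /enters /=; case: (y.2) => [/hl|/hu].
case: eqP dir => //= _ /andP[/eqP kV /eqP xy]; apply/andP; split.
  by move: kW; rewrite kV; case: (x.2) => -[//|<-].
by apply/eqP=> /(gi _ _ xF yF).
Qed.

Lemma morph_cycle_free : cycle_free G -> cycle_free F.
Proof.
move=> /cycle_freeP cf; apply/cycle_freeP=> p [Dp up hp].
apply: (cf (map dmap p)); split; first exact: morph_ai_dpath.
  rewrite fst_dmap map_inj_in_uniq //.
  case: gm => gi _ _ x y xp yp; apply: gi.
    by case/mapP: xp => z zp ->; case/and3P: Dp => _ /allP/(_ z zp).
  by case/mapP: yp => z zp ->; case/and3P: Dp => _ /allP/(_ z zp).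
case: p Dp {up} hp => // x p _ /hasP[V VF /andP[en ex]].
case: gm => _ _ /(_ V VF) [W [WG hu hl _]]; apply/hasP; exists W => //=.
rewrite last_map /=; apply/andP; split.
  by move: en; rewrite /enters /=; case: (x.2) => [/hl|/hu].
by move: ex; rewrite /exits /=; case: (last x p).2 => [/hu|/hl].
Qed.

Lemma morph_conn_down s : conn_down F s -> conn_down G (map g s).
Proof.
move=> /conn_downP[/dpathP[s0 sF ss] hs ls]; apply/conn_downP.
case: s s0 sF ss hs ls => // e s _ sF ss hs ls; split.
- apply/dpathP; split=> //.
    by rewrite all_map; apply: sub_all sF => x; case: gm => _ /(_ x).
  by rewrite sorted_map; apply: sub_sorted ss => x y; apply: morph_step.
- exact: morph_int.
- by rewrite /= last_map; apply: morph_coint.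
Qed.

Lemma morph_all_clean : all_clean G -> all_clean F.
Proof.
move=> cl s As; split=> // i j ij js.
have /cl[_ /(_ i j ij)] : ai_path G (map g s).
  move/ai_pathP: As => [p Dp ->]; apply/ai_pathP; exists (map dmap p).
    exact: morph_ai_dpath.
  by rewrite fst_dmap.
rewrite size_map => /(_ js) H Hc; apply: H; rewrite -map_take -map_drop.
by case: Hc => /morph_conn_down; [left | right; rewrite -map_rev].
Qed.

End Morphism.

(** * Dangling edges and the lists of attached ends *)

Lemma dang_loP F e f : dang_lo F e -> step F e f = false.
Proof.
move=> /hasPn H; apply/negP=> /hasP[V /H /negbTE nV /andP[]].
by rewrite nV.
Qed.

Lemma dang_lo_coint F e : dang_lo F e -> coint_edge F e = false.
Proof. by move=> /hasPn H; apply/negP=> /hasP[V /H /negbTE nV /andP[_]]; rewrite nV. Qed.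

Lemma dang_upE F e : dang_up F e = (e \notin flatten (map vlo (fverts F))).
Proof.
congr negb; apply/hasP/flattenP => [[V VF eV]|[s /mapP[V VF ->] eV]]; last by exists V.
by exists (vlo V) => //; apply: map_f.
Qed.

Lemma dang_loE F e : dang_lo F e = (e \notin flatten (map vup (fverts F))).
Proof.
congr negb; apply/hasP/flattenP => [[V VF eV]|[s /mapP[V VF ->] eV]]; last by exists V.
by exists (vup V) => //; apply: map_f.
Qed.

Lemma flatten_vup_mem F e : wf_flow F -> e \in flatten (map vup (fverts F)) -> e \in fedges F.
Proof.
move=> [_ H _ _] /flattenP[s /mapP[V VF ->] eV].
by case: (H V VF) => _ [_]; apply; rewrite mem_cat eV.
Qed.

Lemma flatten_vlo_mem F e : wf_flow F -> e \in flatten (map vlo (fverts F)) -> e \in fedges F.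
Proof.
move=> [_ H _ _] /flattenP[s /mapP[V VF ->] eV].
by case: (H V VF) => _ [_]; apply; rewrite mem_cat eV orbT.
Qed.

(** A row of contractions or cocontractions lists its paired edges interleaved; after this
    reordering the two families can be treated separately. *)
Lemma perm_flatten_pairs (f g : nat -> nat) s :
  perm_eq (flatten [seq [:: f e; g e] | e <- s]) (map f s ++ map g s).
Proof.
elim: s => //= x s IH; rewrite perm_cons.
by rewrite perm_sym -cat1s perm_catCA perm_cons perm_sym.
Qed.

Lemma flatten_singletons (f : nat -> nat) s : flatten [seq [:: f e] | e <- s] = map f s.
Proof. by elim: s => //= x s ->. Qed.

(** * Gluing two flows *)

(** The shape of [glue] with the naming maps made independent: [a1], [b1] name dangling edges in
    [D1], and [a2], [b2] in [D2]. *)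
Definition glued (D1 D2 : flow) (g : nat) (Us Ls : seq nat)
    (U L a1 a2 b1 b2 : nat -> nat) : flow :=
  Flow (map U Us ++ map L Ls ++ fedges D1 ++ [seq e <- fedges D2 | e != g])
       (fverts D1 ++ fverts D2 ++
          [seq (KCocontr, [:: U e], [:: a1 e; a2 e]) | e <- Us] ++
          [seq (KContr, [:: b1 e; b2 e], [:: L e]) | e <- Ls]).

(** The two parts share only [g], which dangles below in [D1] and above in [D2], and the new names
    avoid both parts. Apart from [g], a name thus tells where its edge lies. *)
Record glueable (D1 D2 : flow) (g : nat) (Us Ls : seq nat)
    (U L a1 a2 b1 b2 : nat -> nat) : Prop := Glueable {
  gl_wf1 : wf_flow D1;
  gl_wf2 : wf_flow D2;
  gl_g1 : g \in fedges D1;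
  gl_lg : dang_lo D1 g;
  gl_g2 : g \in fedges D2;
  gl_ug : dang_up D2 g;
  gl_share : forall e, e \in fedges D1 -> e \in fedges D2 -> e = g;
  gl_uUs : uniq Us;
  gl_uLs : uniq Ls;
  gl_a1 : forall e, e \in Us -> a1 e \in fedges D1 /\ dang_up D1 (a1 e);
  gl_a2 : forall e, e \in Us ->
    [/\ a2 e \in fedges D2, dang_up D2 (a2 e) & a2 e <> g];
  gl_b1 : forall e, e \in Ls ->
    [/\ b1 e \in fedges D1, dang_lo D1 (b1 e) & b1 e <> g];
  gl_b2 : forall e, e \in Ls -> b2 e \in fedges D2 /\ dang_lo D2 (b2 e);
  gl_ia1 : {in Us &, injective a1};
  gl_ia2 : {in Us &, injective a2};
  gl_ib1 : {in Ls &, injective b1};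
  gl_ib2 : {in Ls &, injective b2};
  gl_iU : {in Us &, injective U};
  gl_iL : {in Ls &, injective L};
  gl_UL : forall e f, e \in Us -> f \in Ls -> U e <> L f;
  gl_UD : forall e, e \in Us -> U e \notin fedges D1 ++ fedges D2;
  gl_LD : forall e, e \in Ls -> L e \notin fedges D1 ++ fedges D2
}.

Section Glue.
Variables (D1 D2 : flow) (g : nat) (Us Ls : seq nat) (U L a1 a2 b1 b2 : nat -> nat).
Hypothesis G : glueable D1 D2 g Us Ls U L a1 a2 b1 b2.

Let wf1 := gl_wf1 G.
Let wf2 := gl_wf2 G.
Let g1 := gl_g1 G.
Let lg := gl_lg G.
Let g2 := gl_g2 G.
Let ug := gl_ug G.
Let share := gl_share G.
Let uUs := gl_uUs G.
Let uLs := gl_uLs G.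
Let Ha1 := gl_a1 G.
Let Ha2 := gl_a2 G.
Let Hb1 := gl_b1 G.
Let Hb2 := gl_b2 G.
Let ia1 := gl_ia1 G.
Let ia2 := gl_ia2 G.
Let ib1 := gl_ib1 G.
Let ib2 := gl_ib2 G.
Let iU := gl_iU G.
Let iL := gl_iL G.
Let UL := gl_UL G.
Let UD := gl_UD G.
Let LD := gl_LD G.

Local Notation C := (glued D1 D2 g Us Ls U L a1 a2 b1 b2).

Lemma U_notin1 e : e \in Us -> U e \in fedges D1 -> False.
Proof. by move=> /UD; rewrite mem_cat => /norP[/negP]. Qed.
Lemma U_notin2 e : e \in Us -> U e \in fedges D2 -> False.
Proof. by move=> /UD; rewrite mem_cat => /norP[_ /negP]. Qed.
Lemma L_notin1 e : e \in Ls -> L e \in fedges D1 -> False.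
Proof. by move=> /LD; rewrite mem_cat => /norP[/negP]. Qed.
Lemma L_notin2 e : e \in Ls -> L e \in fedges D2 -> False.
Proof. by move=> /LD; rewrite mem_cat => /norP[_ /negP]. Qed.

Lemma step_gluedP x y : step C x y ->
  [\/ step D1 x y, step D2 x y,
      exists2 e, e \in Us & x = U e /\ (y = a1 e \/ y = a2 e) |
      exists2 f, f \in Ls & y = L f /\ (x = b1 f \/ x = b2 f)].
Proof.
rewrite /step /= !has_cat => /or4P[]; [by constructor 1 | by constructor 2 | |].
  move=> /hasP[_ /mapP[e eU ->]]; rewrite /vup /vlo /= !inE.
  move=> /andP[/eqP-> /orP ye]; constructor 3; exists e => //; split=> //.
  by case: ye => /eqP; [left | right].
move=> /hasP[_ /mapP[e eL ->]]; rewrite /vup /vlo /= !inE.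
move=> /andP[/orP xe /eqP->]; constructor 4; exists e => //; split=> //.
by case: xe => /eqP; [left | right].
Qed.

(** Besides a step inside [D1], the ways down are through [g] or into a contraction. The last case
    has two forms because [g] may also dangle below in [D2], and then be some [b2 f]. *)
Lemma step_glued1 x y : x \in fedges D1 -> step C x y ->
  [\/ step D1 x y, x = g /\ step D2 g y |
      exists2 f, f \in Ls & y = L f /\ (x = b1 f \/ x = g /\ g = b2 f)].
Proof.
move=> x1 /step_gluedP[]; first by constructor 1.
- move=> xy; have [x2 _] := step_mem wf2 xy.
  by constructor 2; rewrite -(share x1 x2).
- by move=> [e eU [ex _]]; move: x1; rewrite ex => /(U_notin1 eU).
move=> [f fL [ef xf]]; constructor 3; exists f => //; split=> //.
case: xf => xf; [by left | right].
have xg : x = g by apply: share => //; rewrite xf; case: (Hb2 fL).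
by rewrite -xf.
Qed.

(** No step leads from [D2] back into [D1]: the only shared edge [g] dangles below in [D1]. *)
Lemma step_glued2 x y : x \in fedges D2 -> step C x y ->
  step D2 x y \/ exists2 f, f \in Ls & y = L f /\ x = b2 f.
Proof.
move=> x2 /step_gluedP[]; last 1 first.
- move=> [f fL [ef [xf|xf]]]; last by right; exists f.
  have [b1D _ []] := Hb1 fL; apply: share => //; by rewrite -xf.
- move=> xy; have [x1 _] := step_mem wf1 xy.
  by move: xy; rewrite (share x1 x2) dang_loP.
- by left.
- by move=> [e eU [ex _]]; move: x2; rewrite ex => /(U_notin2 eU).
Qed.

Lemma step_gluedU e y : e \in Us -> step C (U e) y -> y = a1 e \/ y = a2 e.
Proof.
move=> eU /step_gluedP[].
- by move=> /(step_mem wf1)[/(U_notin1 eU)].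
- by move=> /(step_mem wf2)[/(U_notin2 eU)].
- by move=> [f fU [/(iU eU fU) <-]].
move=> [f fL [_ [] ef]].
  by case: (U_notin1 eU); rewrite ef; case: (Hb1 fL).
by case: (U_notin2 eU); rewrite ef; case: (Hb2 fL).
Qed.

Lemma step_gluedL f y : f \in Ls -> ~ step C (L f) y.
Proof.
move=> fL /step_gluedP[].
- by move=> /(step_mem wf1)[/(L_notin1 fL)].
- by move=> /(step_mem wf2)[/(L_notin2 fL)].
- by move=> [e eU [/esym/(UL eU fL)]].
move=> [e eL [_ [] ef]].
  by case: (L_notin1 fL); rewrite ef; case: (Hb1 eL).
by case: (L_notin2 fL); rewrite ef; case: (Hb2 eL).
Qed.

Lemma reach_gluedL f y : f \in Ls -> reach C (L f) y -> y = L f.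
Proof. by move=> fL [[|z s] /=]; [|move=> /andP[/step_gluedL]; case]. Qed.

Lemma reach_glued2 x y : x \in fedges D2 -> reach C x y ->
  (y \in fedges D2 /\ reach D2 x y) \/
  exists2 f, f \in Ls & y = L f /\ reach D2 x (b2 f).
Proof.
move=> x2 [s ps <-]; elim: s x x2 ps => [|z s IH] x x2 /=.
  by move=> _; left; split=> //; apply: reach_refl.
move=> /andP[/(step_glued2 x2)[xz|[f fL [zf xf]]]] ps.
  have [_ z2] := step_mem wf2 xz.
  case: (IH z z2 ps) => [[l2 zl]|[f fL [lf zb]]]; [left|right].
    by split=> //; apply: reach_stepl zl.
  by exists f => //; split=> //; apply: reach_stepl zb.
right; exists f => //; rewrite -xf; split; last exact: reach_refl.
by apply: reach_gluedL => //; rewrite -zf; exists s.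
Qed.

(** Induction along the path, which can cross from [D1] to [D2] only once, at [g]; from there
    [reach_glued2] takes over. *)
Lemma reach_glued1 x y : x \in fedges D1 -> reach C x y ->
  [\/ y \in fedges D1 /\ reach D1 x y,
      [/\ y \in fedges D2, reach D1 x g & reach D2 g y] |
      exists2 f, f \in Ls &
        y = L f /\ (reach D1 x (b1 f) \/ (reach D1 x g /\ reach D2 g (b2 f)))].
Proof.
move=> x1 [s ps <-]; elim: s x x1 ps => [|z s IH] x x1.
  by move=> _; constructor 1; split=> //; apply: reach_refl.
move=> pxs; have := pxs; move=> /= /andP[/(step_glued1 x1)[xz|[xg _]|[f fL [zf xf]]]] ps.
- have [_ z1] := step_mem wf1 xz; case: (IH z z1 ps) => [[l1 zl]|[l2 zl gl]|[f fL [lf zb]]].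
  + by constructor 1; split=> //; apply: reach_stepl zl.
  + by constructor 2; split=> //; apply: reach_stepl zl.
  constructor 3; exists f => //; split=> //.
  by case: zb => [zb|[zb bf]]; [left|right; split=> //]; apply: reach_stepl zb.
- have : reach C g (last z s) by exists (z :: s); rewrite // -xg.
  move=> /(reach_glued2 g2)[[l2 gl]|[f fL [lf gl]]]; [constructor 2|constructor 3].
    by split=> //; rewrite xg; apply: reach_refl.
  by exists f => //; split=> //; right; split=> //; rewrite xg; apply: reach_refl.
constructor 3; exists f => //; split.
  by apply: reach_gluedL => //; rewrite -zf; exists s.
case: xf => [->|[-> <-]]; [left|right; split]; exact: reach_refl.
Qed.

Lemma reach_gluedU e y : e \in Us -> reach C (U e) y ->
  [\/ y = U e, reach C (a1 e) y | reach C (a2 e) y].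
Proof.
move=> eU [[|z s] /=]; first by constructor 1.
move=> /andP[/(step_gluedU eU) [] -> ps] ls; [constructor 2|constructor 3]; by exists s.
Qed.

Lemma int_gluedP e : int_edge C e -> int_edge D1 e \/ int_edge D2 e.
Proof.
rewrite /int_edge /= !has_cat => /or4P[]; [by left|by right| |];
by move=> /hasP[_ /mapP[f fU ->]].
Qed.

Lemma coint_gluedP e : coint_edge C e -> coint_edge D1 e \/ coint_edge D2 e.
Proof.
rewrite /coint_edge /= !has_cat => /or4P[]; [by left|by right| |];
by move=> /hasP[_ /mapP[f fU ->]].
Qed.

Lemma coint_gluedL f : f \in Ls -> ~ coint_edge C (L f).
Proof.
move=> fL /coint_gluedP[] /coint_edge_mem H.
  exact: L_notin1 (H wf1).
exact: L_notin2 (H wf2).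
Qed.

(** Gluing adds no interaction, so one above [L f] lies in [D1] or [D2], and its path arrives
    through [b1 f], through [g] and then [b2 f], or directly through [b2 f]. *)
Lemma from_int_gluedL f : f \in Ls -> from_int C (L f) ->
  [\/ from_int D1 (b1 f), from_int D1 g /\ reach D2 g (b2 f) | from_int D2 (b2 f)].
Proof.
move=> fL [e /int_gluedP[] ie].
  move=> /(reach_glued1 (int_edge_mem wf1 ie))[[/(L_notin1 fL)]//|[/(L_notin2 fL)]//|].
  move=> [f' f'L [/(iL fL f'L) <-]] [r|[r r']]; [constructor 1|constructor 2]; last split=> //;
    by exists e.
move=> /(reach_glued2 (int_edge_mem wf2 ie))[[/(L_notin2 fL)]//|].
by move=> [f' f'L [/(iL fL f'L) <-]] r; constructor 3; exists e.
Qed.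

Lemma to_coint_glued1 x : x \in fedges D1 -> to_coint C x ->
  to_coint D1 x \/ (reach D1 x g /\ to_coint D2 g).
Proof.
move=> x1 [y cy /(reach_glued1 x1)[[y1 xy]|[y2 xg gy]|[f fL [yf _]]]].
- case: (coint_gluedP cy) => cy'; first by left; exists y.
  (* A cointeraction of [D2] attached to an edge of [D1] can only be attached to [g]. *)
  have yg := share y1 (coint_edge_mem wf2 cy'); right.
  by rewrite -{1}yg; split=> //; exists y => //; rewrite yg; apply: reach_refl.
- case: (coint_gluedP cy) => cy'; last by right; split=> //; exists y.
  have yg := share (coint_edge_mem wf1 cy') y2.
  by move: cy'; rewrite yg dang_lo_coint.
- by move: cy; rewrite yf => /(coint_gluedL fL).
Qed.

Lemma to_coint_glued2 x : x \in fedges D2 -> to_coint C x -> to_coint D2 x.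
Proof.
move=> x2 [y cy /(reach_glued2 x2)[[y2 xy]|[f fL [yf _]]]].
- case: (coint_gluedP cy) => cy'; last by exists y.
  have yg := share (coint_edge_mem wf1 cy') y2.
  by move: cy'; rewrite yg dang_lo_coint.
- by move: cy; rewrite yf => /(coint_gluedL fL).
Qed.

Lemma to_coint_gluedU e : e \in Us -> to_coint C (U e) ->
  [\/ to_coint D1 (a1 e), reach D1 (a1 e) g /\ to_coint D2 g | to_coint D2 (a2 e)].
Proof.
move=> eU [y cy /(reach_gluedU eU)[yU|r|r]].
- move: cy; rewrite yU => /coint_gluedP[] /coint_edge_mem H.
    by case: (U_notin1 eU (H wf1)).
  by case: (U_notin2 eU (H wf2)).
- have [a1D _] := Ha1 eU.
  by case: (@to_coint_glued1 (a1 e)) => //; [exists y|constructor 1|constructor 2].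
have [a2D _ _] := Ha2 eU.
by constructor 3; apply: to_coint_glued2 => //; exists y.
Qed.

(** A connection lies inside one part or crosses [g]; only the crossing case is new. *)
Lemma connected_glued : connected C ->
  [\/ connected D1, connected D2 | from_int D1 g /\ to_coint D2 g].
Proof.
move=> [e /int_gluedP[] ie].
  move=> /(to_coint_glued1 (int_edge_mem wf1 ie))[c|[eg c]].
    by constructor 1; exists e.
  by constructor 3; split=> //; exists e.
move=> /(to_coint_glued2 (int_edge_mem wf2 ie)) c.
by constructor 2; exists e.
Qed.

Lemma reach_gluedUL e f : e \in Us -> f \in Ls -> reach C (U e) (L f) ->
  [\/ reach D1 (a1 e) (b1 f), reach D1 (a1 e) g /\ reach D2 g (b2 f) |
      reach D2 (a2 e) (b2 f)].
Proof.
move=> eU fL /(reach_gluedU eU)[/esym/(UL eU fL)//||].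
  have [a1D _] := Ha1 eU.
  move=> /(reach_glued1 a1D)[[/(L_notin1 fL)]//|[/(L_notin2 fL)]//|].
  by move=> [f' f'L [/(iL fL f'L) <-]] [r|r]; [constructor 1|constructor 2].
have [a2D _ _] := Ha2 eU.
move=> /(reach_glued2 a2D)[[/(L_notin2 fL)]//|].
by move=> [f' f'L [/(iL fL f'L) <-]] r; constructor 3.
Qed.

(** Steps never lead backwards in the order: names [U e], [D1], [D2], names [L f]. A cycle would
    therefore stay inside [D1] or inside [D2]. *)
Lemma acyclic_glued : acyclic D1 -> acyclic D2 -> acyclic C.
Proof.
move=> ac1 ac2 x y xy yx.
have yL f : f \in Ls -> y = L f -> False.
  move=> fL yf; move: yx; rewrite yf => /(reach_gluedL fL) xf.
  by apply: (step_gluedL fL (y := y)); rewrite -xf.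
have xL f : f \in Ls -> x = L f -> False.
  by move=> fL xf; apply: (step_gluedL fL (y := y)); rewrite -xf.
case: (step_gluedP xy) => [h|h|[e eU [xe ye]]|[f fL [yf _]]]; last exact: yL yf.
- have [x1 y1] := step_mem wf1 h.
  case: (reach_glued1 y1 yx) => [[_ /(ac1 _ _ h)]//|[x2 _ _]|[f fL [xf _]]].
    by move: h; rewrite (share x1 x2) dang_loP.
  exact: xL xf.
- have [x2 y2] := step_mem wf2 h.
  by case: (reach_glued2 y2 yx) => [[_ /(ac2 _ _ h)]//|[f fL [xf _]]]; apply: xL xf.
case: ye => ye.
  have y1 : y \in fedges D1 by rewrite ye; case: (Ha1 eU).
  case: (reach_glued1 y1 yx) => [[]|[]|[f fL [xf _]]]; rewrite ?xe.
  - by move/(U_notin1 eU).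
  - by move/(U_notin2 eU).
  exact: xL xf.
have y2 : y \in fedges D2 by rewrite ye; case: (Ha2 eU).
case: (reach_glued2 y2 yx) => [[]|[f fL [xf _]]]; rewrite ?xe.
  by move/(U_notin2 eU).
exact: xL xf.
Qed.

Lemma mem_glued1 e : e \in fedges D1 -> e \in fedges C.
Proof. by rewrite /= !mem_cat => ->; rewrite !orbT. Qed.
Lemma mem_glued2 e : e \in fedges D2 -> e \in fedges C.
Proof.
move=> e2; case: (eqVneq e g) => [->|ne]; first exact: mem_glued1.
by rewrite /= !mem_cat mem_filter ne e2 !orbT.
Qed.
Lemma mem_gluedU e : e \in Us -> U e \in fedges C.
Proof. by move=> eU; rewrite /= !mem_cat map_f. Qed.
Lemma mem_gluedL e : e \in Ls -> L e \in fedges C.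
Proof. by move=> eL; rewrite /= !mem_cat (map_f L eL) orbT. Qed.

Lemma b12 e f : e \in Ls -> f \in Ls -> b1 e <> b2 f.
Proof.
move=> eL fL ef; have [b1D _ []] := Hb1 eL; apply: share => //.
by rewrite ef; case: (Hb2 fL).
Qed.

Lemma a12 e f : e \in Us -> f \in Us -> a1 e <> a2 f.
Proof.
move=> eU fU ef; have [a1D _] := Ha1 eU; have [a2D _ []] := Ha2 fU.
by apply: share => //; rewrite -ef.
Qed.

Lemma wf_glued : wf_flow C.
Proof.
have [u1 v1 uu1 ul1] := wf1; have [u2 v2 uu2 ul2] := wf2.
split.
- rewrite /= !cat_uniq (map_inj_in_uniq iU) (map_inj_in_uniq iL) uUs uLs u1 filter_uniq //=.
  rewrite andbT; apply/and3P; split; apply/hasPn=> x.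
  + rewrite !mem_cat => H; apply/mapP=> -[e eU xe]; move: H; rewrite xe.
    case/or3P=> [/mapP[f fL /(UL eU fL)]|/(U_notin1 eU)|] //.
    by rewrite mem_filter => /andP[_ /(U_notin2 eU)].
  + rewrite !mem_cat => H; apply/mapP=> -[e eL xe]; move: H; rewrite xe.
    case/orP=> [/(L_notin1 eL)|]; first by [].
    by rewrite mem_filter => /andP[_ /(L_notin2 eL)].
  + rewrite mem_filter => /andP[/eqP xg x2]; apply/negP=> x1.
    by case: xg; apply: share.
- move=> V; rewrite /= !mem_cat => /or4P[].
  + by move=> /v1[? [? s]]; split=> //; split=> // e /s; apply: mem_glued1.
  + by move=> /v2[? [? s]]; split=> //; split=> // e /s; apply: mem_glued2.
  + move=> /mapP[e eU ->]; split=> //; rewrite /vup /vlo /=.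
    have [a1D _] := Ha1 eU; have [a2D _ _] := Ha2 eU; split.
      rewrite !inE !andbT; apply/andP; split; last by apply/eqP/a12.
      apply/norP; split; apply/eqP=> h.
        by apply: (U_notin1 eU); rewrite h.
      by apply: (U_notin2 eU); rewrite h.
    move=> x; rewrite !inE => /or3P[] /eqP ->.
    * exact: mem_gluedU.
    * exact: mem_glued1.
    * exact: mem_glued2.
  + move=> /mapP[e eL ->]; split=> //; rewrite /vup /vlo /=.
    have [b1D _ _] := Hb1 eL; have [b2D _] := Hb2 eL; split.
      rewrite !inE !andbT; apply/andP; split.
        apply/norP; split; apply/eqP; first exact: b12.
        by move=> h; apply: (L_notin1 eL); rewrite -h.
      by apply/eqP => h; apply: (L_notin2 eL); rewrite -h.
    move=> x; rewrite !inE => /or3P[] /eqP ->.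
    * exact: mem_glued1.
    * exact: mem_glued2.
    * exact: mem_gluedL.
(* No edge gets two lower ends: [b1 e] and [b2 e] dangled below, [U e] is new, and [g] has no lower
   end in [D1]. *)
- rewrite /= !map_cat !flatten_cat -!map_comp /comp /vup /= flatten_singletons.
  rewrite !cat_uniq uu1 uu2 (map_inj_in_uniq iU) uUs.
  rewrite (perm_uniq (perm_flatten_pairs _ _ _)) cat_uniq.
  rewrite (map_inj_in_uniq ib1) (map_inj_in_uniq ib2) uLs /= !andbT.
  apply/and4P; split; apply/hasPn=> x.
  + rewrite !mem_cat (perm_mem (perm_flatten_pairs _ _ _)) mem_cat.
    move=> H; apply/negP=> x1; move: H (flatten_vup_mem wf1 x1) => /or4P[].
    * move=> /(flatten_vup_mem wf2) x2 x1'.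
      by move: x1; apply/negP; rewrite (share x1' x2) -dang_loE.
    * by move=> /mapP[e eU ->] /(U_notin1 eU).
    * move=> /mapP[e eL xe] _; have [_ + _] := Hb1 eL.
      by rewrite dang_loE -xe => /negP.
    * move=> /mapP[e eL xe] x1'; have [b2D _] := Hb2 eL.
      move: x1; apply/negP; rewrite (share x1') -?dang_loE //; by rewrite xe.
  + rewrite !mem_cat (perm_mem (perm_flatten_pairs _ _ _)) mem_cat.
    move=> H; apply/negP=> x2; move: H (flatten_vup_mem wf2 x2) => /or3P[].
    * by move=> /mapP[e eU ->] /(U_notin2 eU).
    * move=> /mapP[e eL xe] x2'; have [b1D _ []] := Hb1 eL.
      by apply: share => //; rewrite -xe.
    * move=> /mapP[e eL xe] _; have [_] := Hb2 eL.
      by rewrite dang_loE -xe => /negP.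
  + rewrite (perm_mem (perm_flatten_pairs _ _ _)) mem_cat.
    move=> H; apply/mapP=> -[e eU xe]; move: H; rewrite xe => /orP[] /mapP[f fL h].
      by apply: (U_notin1 eU); rewrite h; case: (Hb1 fL).
    by apply: (U_notin2 eU); rewrite h; case: (Hb2 fL).
  + move=> /mapP[e eL ->]; apply/mapP=> -[f fL h].
    exact: (b12 fL eL).
(* Dually, no edge gets two upper ends: [a1 e] and [a2 e] dangled above, [L e] is new, and [g] has
   no upper end in [D2]. *)
- rewrite /= !map_cat !flatten_cat -!map_comp /comp /vlo /= flatten_singletons.
  rewrite !cat_uniq ul1 ul2 (map_inj_in_uniq iL) uLs.
  rewrite (perm_uniq (perm_flatten_pairs _ _ _)) cat_uniq.
  rewrite (map_inj_in_uniq ia1) (map_inj_in_uniq ia2) uUs /= !andbT.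
  apply/and4P; split; last 1 first.
  + apply/hasPn=> x /mapP[e eL xe]; apply/negP.
    rewrite (perm_mem (perm_flatten_pairs _ _ _)) mem_cat xe.
    move=> /orP[] /mapP[f fU h].
      by apply: (L_notin1 eL); rewrite h; case: (Ha1 fU).
    by apply: (L_notin2 eL); rewrite h; case: (Ha2 fU).
  + apply/hasPn=> x; rewrite !mem_cat (perm_mem (perm_flatten_pairs _ _ _)) mem_cat -orbA.
    move=> H; apply/negP=> x1; move: H (flatten_vlo_mem wf1 x1) => /or4P[].
    * move=> x2' x1'; have x2 := flatten_vlo_mem wf2 x2'.
      by move: x2'; apply/negP; rewrite (share x1' x2) -dang_upE.
    * move=> /mapP[e eU xe] _; have [_] := Ha1 eU.
      by rewrite dang_upE -xe => /negP.
    * move=> /mapP[e eU xe] x1'; have [a2D _ []] := Ha2 eU.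
      by rewrite -xe; apply: share => //; rewrite xe.
    * by move=> /mapP[e eL ->] /(L_notin1 eL).
  + apply/hasPn=> x; rewrite !mem_cat (perm_mem (perm_flatten_pairs _ _ _)) mem_cat -orbA.
    move=> H; apply/negP=> x2; move: H (flatten_vlo_mem wf2 x2) => /or3P[].
    * move=> /mapP[e eU xe] x2'; have [a1D _] := Ha1 eU.
      move: x2; apply/negP; rewrite (share _ x2') -?dang_upE //; by rewrite xe.
    * move=> /mapP[e eU xe] _; have [_ + _] := Ha2 eU.
      by rewrite dang_upE -xe => /negP.
    * by move=> /mapP[e eL ->] /(L_notin2 eL).
  + apply/hasPn=> x /mapP[e eU ->]; apply/mapP=> -[f fU h].
    exact: (a12 fU eU).
Qed.

Lemma dang_up_glued e : e \in Us -> dang_up C (U e).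
Proof.
move=> eU; rewrite dang_upE /= !map_cat !flatten_cat -!map_comp /comp /vlo /=.
rewrite flatten_singletons !mem_cat (perm_mem (perm_flatten_pairs _ _ _)) mem_cat.
apply/negP=> /or4P[].
- by move=> /(flatten_vlo_mem wf1)/(U_notin1 eU).
- by move=> /(flatten_vlo_mem wf2)/(U_notin2 eU).
- move=> /orP[] /mapP[f fU h].
    by apply: (U_notin1 eU); rewrite h; case: (Ha1 fU).
  by apply: (U_notin2 eU); rewrite h; case: (Ha2 fU).
- by move=> /mapP[f fL /(UL eU fL)].
Qed.

Lemma dang_lo_glued e : e \in Ls -> dang_lo C (L e).
Proof.
move=> eL; rewrite dang_loE /= !map_cat !flatten_cat -!map_comp /comp /vup /=.
rewrite flatten_singletons !mem_cat (perm_mem (perm_flatten_pairs _ _ _)) mem_cat.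
apply/negP=> /or4P[].
- by move=> /(flatten_vup_mem wf1)/(L_notin1 eL).
- by move=> /(flatten_vup_mem wf2)/(L_notin2 eL).
- by move=> /mapP[f fU /esym/(UL fU eL)].
- move=> /orP[] /mapP[f fL h].
    by apply: (L_notin1 eL); rewrite h; case: (Hb1 fL).
  by apply: (L_notin2 eL); rewrite h; case: (Hb2 fL).
Qed.

(** Two polarities that agree on [g] amalgamate, and each new vertex joins edges to which [pU] or
    [pL] prescribes one common value. *)
Lemma polarity_glued pU pL p1 p2 :
  polarity_ok D1 p1 -> polarity_ok D2 p2 -> p1 g = p2 g ->
  (forall e, e \in Us -> p1 (a1 e) = pU e /\ p2 (a2 e) = pU e) ->
  (forall e, e \in Ls -> p1 (b1 e) = pL e /\ p2 (b2 e) = pL e) ->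
  exists pol, [/\ polarity_ok C pol, forall e, e \in Us -> pol (U e) = pU e &
                  forall e, e \in Ls -> pol (L e) = pL e].
Proof.
move=> P1 P2 pg PU PL.
(* A left inverse of [f] on [s]; the default 0 is never reached on images of elements of [s]. *)
pose look (f : nat -> nat) (s : seq nat) x := nth 0 s (index x (map f s)).
have lookE f s e : {in s &, injective f} -> e \in s -> look f s (f e) = e.
  move=> fi es; rewrite /look.
  have ef : index (f e) (map f s) < size s by rewrite -(size_map f) index_mem map_f.
  by apply: fi; rewrite ?mem_nth // -(nth_map 0 0) // nth_index // map_f.
pose pol x := if x \in fedges D1 then p1 x else if x \in fedges D2 then p2 x
  else if x \in map U Us then pU (look U Us x) else pL (look L Ls x).
have pol1 x : x \in fedges D1 -> pol x = p1 x by rewrite /pol => ->.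
have pol2 x : x \in fedges D2 -> pol x = p2 x.
  by move=> x2; rewrite /pol x2; case: ifP => // x1; rewrite (share x1 x2).
have polU e : e \in Us -> pol (U e) = pU e.
  move=> eU; rewrite /pol map_f // (lookE U) //.
  by case: ifP => [/(U_notin1 eU)//|_]; case: ifP => [/(U_notin2 eU)//|].
have polL e : e \in Ls -> pol (L e) = pL e.
  move=> eL; rewrite /pol (lookE L) //.
  case: ifP => [/(L_notin1 eL)//|_]; case: ifP => [/(L_notin2 eL)//|_].
  by case: ifP => // /mapP[f fU /esym/(UL fU eL)].
exists pol; split=> // V; rewrite /= !mem_cat => /or4P[].
- move=> VD; have [_ /(_ V VD)[_ [_ sV]] _ _] := wf1.
  have pe e : e \in vup V ++ vlo V -> pol e = p1 e by move=> /sV/pol1.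
  have pu e : e \in vup V -> pol e = p1 e by move=> eV; apply: pe; rewrite mem_cat eV.
  have pl e : e \in vlo V -> pol e = p1 e by move=> eV; apply: pe; rewrite mem_cat eV orbT.
  move: (P1 V VD); case: (vkind V) => // H e f eV fV.
  + by rewrite !pl //; apply: H.
  + by rewrite !pu //; apply: H.
  + by rewrite !pe //; apply: H.
  + by rewrite !pe //; apply: H.
- move=> VD; have [_ /(_ V VD)[_ [_ sV]] _ _] := wf2.
  have pe e : e \in vup V ++ vlo V -> pol e = p2 e by move=> /sV/pol2.
  have pu e : e \in vup V -> pol e = p2 e by move=> eV; apply: pe; rewrite mem_cat eV.
  have pl e : e \in vlo V -> pol e = p2 e by move=> eV; apply: pe; rewrite mem_cat eV orbT.
  move: (P2 V VD); case: (vkind V) => // H e f eV fV.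
  + by rewrite !pl //; apply: H.
  + by rewrite !pu //; apply: H.
  + by rewrite !pe //; apply: H.
  + by rewrite !pe //; apply: H.
- move=> /mapP[e eU ->] /=.
  have [a1D _] := Ha1 eU; have [a2D _ _] := Ha2 eU; have [q1 q2] := PU e eU.
  have E x : x \in [:: U e; a1 e; a2 e] -> pol x = pU e.
    rewrite !inE => /or3P[] /eqP ->; first exact: polU.
      by rewrite pol1.
    by rewrite pol2.
  by move=> x y /E -> /E ->.
- move=> /mapP[e eL ->] /=.
  have [b1D _ _] := Hb1 eL; have [b2D _] := Hb2 eL; have [q1 q2] := PL e eL.
  have E x : x \in [:: b1 e; b2 e; L e] -> pol x = pL e.
    rewrite !inE => /or3P[] /eqP ->; last exact: polL.
      by rewrite pol1.
    by rewrite pol2.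
  by move=> x y /E -> /E ->.
Qed.

End Glue.

(** * Injective renaming of edges, and capping a dangling edge *)

Section MapFlow.
Variables (A : flow) (t : nat -> nat).
Hypotheses (wfA : wf_flow A) (tinj : {in fedges A &, injective t}).

Lemma flatten_map_vertex (p : vertex -> seq nat) :
  (forall V, p (map_vertex t V) = map t (p V)) ->
  flatten (map p (fverts (map_flow t A))) = map t (flatten (map p (fverts A))).
Proof. by move=> H; rewrite map_flatten -!map_comp; congr flatten; apply: eq_map. Qed.

Lemma wf_map_flow : wf_flow (map_flow t A).
Proof.
have [u v uu ul] := wfA; split.
- by rewrite /= map_inj_in_uniq.
- move=> _ /mapP[V VA ->]; have [ar [uV sV]] := v V VA; split; last split.
  + by move: ar; rewrite /arity_ok /vup /vlo /= !size_map.
  + by rewrite /vup /vlo /= -map_cat map_inj_in_uniq // => x y /sV xA /sV; apply: tinj.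
  + by move=> x; rewrite /vup /vlo /= -map_cat => /mapP[y /sV yA ->]; apply: map_f.
- rewrite flatten_map_vertex // map_inj_in_uniq // => x y.
  by move=> /(flatten_vup_mem wfA) xA /(flatten_vup_mem wfA); apply: tinj.
- rewrite flatten_map_vertex // map_inj_in_uniq // => x y.
  by move=> /(flatten_vlo_mem wfA) xA /(flatten_vlo_mem wfA); apply: tinj.
Qed.

Lemma dang_up_map e : e \in fedges A -> dang_up (map_flow t A) (t e) = dang_up A e.
Proof.
move=> eA; rewrite !dang_upE flatten_map_vertex //; congr negb.
apply/mapP/idP => [[f fA tf]|]; last by exists e.
by rewrite (tinj eA _ tf) // (flatten_vlo_mem wfA).
Qed.

Lemma dang_lo_map e : e \in fedges A -> dang_lo (map_flow t A) (t e) = dang_lo A e.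
Proof.
move=> eA; rewrite !dang_loE flatten_map_vertex //; congr negb.
apply/mapP/idP => [[f fA tf]|]; last by exists e.
by rewrite (tinj eA _ tf) // (flatten_vup_mem wfA).
Qed.

End MapFlow.

Lemma wf_add_weak F e : wf_flow F -> e \in fedges F -> dang_up F e -> wf_flow (add_weak F e).
Proof.
move=> [u v uu ul] eF de; split=> //=; last by rewrite -dang_upE de.
by move=> V; rewrite inE => /predU1P[->|/v //]; split=> //; split=> // x; rewrite inE => /eqP->.
Qed.

Lemma wf_add_coweak F e : wf_flow F -> e \in fedges F -> dang_lo F e -> wf_flow (add_coweak F e).
Proof.
move=> [u v uu ul] eF de; split=> //=; last by rewrite -dang_loE de.
by move=> V; rewrite inE => /predU1P[->|/v //]; split=> //; split=> // x; rewrite inE => /eqP->.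
Qed.

(** * Splitting off a simple edge *)

(** A concrete form of the equivalence with [add_ic]: the remaining vertices are literally those of
    [B], and only [V1] and [V2] may list their edges in another order. *)
Record ic_split (B A : flow) (e1 e2 e3 : nat) (V1 V2 : vertex) : Prop := IcSplit {
  ic_verts : perm_eq (fverts B) (V1 :: V2 :: fverts A);
  ic_edges : perm_eq (fedges B) (e1 :: fedges A);
  ic_k1 : vkind V1 = KInt;
  ic_u1 : vup V1 = [::];
  ic_l1 : perm_eq (vlo V1) [:: e2; e1];
  ic_k2 : vkind V2 = KCoint;
  ic_u2 : perm_eq (vup V2) [:: e3; e1];
  ic_l2 : vlo V2 = [::];
  ic_23 : e2 != e3
}.

Lemma pair_perm (s : seq nat) e : size s = 2 -> e \in s -> exists f, perm_eq s [:: f; e].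
Proof.
case: s => [|a [|b []]] // _; rewrite !inE => /orP[] /eqP ->; last by exists a.
by exists b; apply/permP=> p /=; lia.
Qed.

Lemma ic_split_exists B e1 : wf_flow B -> cycle_free B ->
  int_edge B e1 -> coint_edge B e1 ->
  exists A e2 e3 V1 V2, ic_split B A e1 e2 e3 V1 V2.
Proof.
move=> wf cf i1 c1; have e1B := int_edge_mem wf i1.
have [V1 V1B /andP[/eqP k1 l1]] := hasP i1.
have [V2 V2B /andP[/eqP k2 u2]] := hasP c1.
have [_ vB _ _] := wf.
have [+ [uq1 _]] := vB V1 V1B; rewrite /arity_ok k1 => /andP[/eqP/size0nil u1 /eqP s1].
have [+ _] := vB V2 V2B; rewrite /arity_ok k2 => /andP[/eqP s2 /eqP/size0nil l2].
have [e2 p2] := pair_perm s1 l1; have [e3 p3] := pair_perm s2 u2.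
have V21 : V2 \in rem V1 (fverts B).
  have := V2B; rewrite (perm_mem (perm_to_rem V1B)) inE => /predU1P[V12|//].
  by move: k2; rewrite V12 k1.
exists (Flow (rem e1 (fedges B)) (rem V2 (rem V1 (fverts B)))), e2, e3, V1, V2.
split=> //=.
- apply: perm_trans (perm_to_rem V1B) _; rewrite perm_cons; exact: perm_to_rem.
- exact: perm_to_rem.
(* If [e2] and [e3] were equal, going down [e1] and back up [e2] would be an ai-cycle at [V1]. *)
apply/eqP=> e23; move: p3; rewrite -e23 => p3.
have n12 : e1 != e2.
  by move: uq1; rewrite u1 /= (perm_uniq p2) /= inE andbT eq_sym.
have [e22 e12] : e2 \in vlo V1 /\ e2 \in vup V2.
  by rewrite (perm_mem p2) (perm_mem p3) !inE eqxx.
have /cycle_freeP/(_ [:: (e1, true); (e2, false)]) := cf; apply; split.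
- apply/and3P; split=> //=.
    rewrite e1B /= andbT; case: wf => _ /(_ _ V1B)[_ [_ H]] _ _.
    by apply: H; rewrite mem_cat e22 orbT.
  by rewrite andbT; apply/hasP; exists V2; rewrite // /joins /exits /enters /= u2 e12 k2.
- by rewrite /= inE n12.
- by apply/hasP; exists V1; rewrite // /enters /exits /= l1 e22.
Qed.

Section Split.
Variables (B A : flow) (e1 e2 e3 : nat) (V1 V2 : vertex).
Hypotheses (wfB : wf_flow B) (S : ic_split B A e1 e2 e3 V1 V2).

Lemma ic_mem_verts V : V \in fverts B = (V \in V1 :: V2 :: fverts A).
Proof. exact: perm_mem (ic_verts S) V. Qed.

Lemma ic_mem_edges e : e \in fedges B = (e == e1) || (e \in fedges A).
Proof. by rewrite (perm_mem (ic_edges S)) inE. Qed.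

Lemma ic_flatten_vlo :
  perm_eq (flatten (map vlo (fverts B))) (e2 :: e1 :: flatten (map vlo (fverts A))).
Proof.
apply: perm_trans (perm_flatten (perm_map _ (ic_verts S))) _.
by rewrite /= (ic_l2 S) /= -[_ :: _ :: _]/([:: e2; e1] ++ _) perm_cat2r (ic_l1 S).
Qed.

Lemma ic_flatten_vup :
  perm_eq (flatten (map vup (fverts B))) (e3 :: e1 :: flatten (map vup (fverts A))).
Proof.
apply: perm_trans (perm_flatten (perm_map _ (ic_verts S))) _.
by rewrite /= (ic_u1 S) /= -[_ :: _ :: _]/([:: e3; e1] ++ _) perm_cat2r (ic_u2 S).
Qed.

Lemma ic_vlo_uniq : uniq (e2 :: e1 :: flatten (map vlo (fverts A))).
Proof. by rewrite -(perm_uniq ic_flatten_vlo); case: wfB. Qed.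

Lemma ic_vup_uniq : uniq (e3 :: e1 :: flatten (map vup (fverts A))).
Proof. by rewrite -(perm_uniq ic_flatten_vup); case: wfB. Qed.

Lemma ic_dang_up : dang_up A e2 /\ dang_up A e1.
Proof.
have := ic_vlo_uniq; rewrite /= inE => /andP[/norP[_ h2] /andP[h1 _]].
by rewrite !dang_upE.
Qed.

Lemma ic_dang_lo : dang_lo A e3 /\ dang_lo A e1.
Proof.
have := ic_vup_uniq; rewrite /= inE => /andP[/norP[_ h2] /andP[h1 _]].
by rewrite !dang_loE.
Qed.

Lemma ic_ne21 : e2 != e1.
Proof. by have := ic_vlo_uniq; rewrite /= inE => /andP[/norP[]]. Qed.

Lemma ic_ne31 : e3 != e1.
Proof. by have := ic_vup_uniq; rewrite /= inE => /andP[/norP[]]. Qed.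

Lemma ic_V1 : V1 \in fverts B. Proof. by rewrite ic_mem_verts !inE eqxx. Qed.
Lemma ic_V2 : V2 \in fverts B. Proof. by rewrite ic_mem_verts !inE eqxx orbT. Qed.

Lemma ic_vloV1 e : e \in vlo V1 = (e == e2) || (e == e1).
Proof. by rewrite (perm_mem (ic_l1 S)) !inE. Qed.

Lemma ic_vupV2 e : e \in vup V2 = (e == e3) || (e == e1).
Proof. by rewrite (perm_mem (ic_u2 S)) !inE. Qed.

Lemma ic_e2A : e2 \in fedges A.
Proof.
have : e2 \in fedges B.
  case: wfB => _ /(_ _ ic_V1)[_ [_ H]] _ _; apply: H.
  by rewrite mem_cat ic_vloV1 eqxx orbT.
by rewrite ic_mem_edges (negbTE ic_ne21).
Qed.

Lemma ic_e3A : e3 \in fedges A.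
Proof.
have : e3 \in fedges B.
  case: wfB => _ /(_ _ ic_V2)[_ [_ H]] _ _; apply: H.
  by rewrite mem_cat ic_vupV2 eqxx.
by rewrite ic_mem_edges (negbTE ic_ne31).
Qed.

Lemma ic_edges_uniq : uniq (e1 :: fedges A).
Proof. by rewrite -(perm_uniq (ic_edges S)); case: wfB. Qed.

Lemma ic_wf : wf_flow A.
Proof.
have [_ vB _ _] := wfB; split.
- by case/andP: ic_edges_uniq.
- move=> V VA; have [|ar [uV sV]] := vB V; first by rewrite ic_mem_verts !inE VA !orbT.
  split=> //; split=> // e eV; have := sV e eV; rewrite ic_mem_edges => /predU1P[ee|//].
  have [[_ /hasPn/(_ V VA) n1] [_ /hasPn/(_ V VA) n2]] := (ic_dang_up, ic_dang_lo).
  by move: eV; rewrite ee mem_cat (negbTE n1) (negbTE n2).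
- by have /= /and3P[_ _] := ic_vup_uniq.
- by have /= /and3P[_ _] := ic_vlo_uniq.
Qed.

Lemma ic_flow_equiv : flow_equiv B (add_ic A e1 e2 e3).
Proof.
split; first exact: ic_edges S.
apply: perm_trans (perm_map _ (ic_verts S)) _ => /=.
have srt s t : perm_eq s t -> sort leq s = sort leq t.
  by move/(perm_sortP leq_total leq_trans anti_leq).
rewrite {1 2}/vnorm (ic_k1 S) (ic_k2 S) (ic_u1 S) (ic_l2 S).
by rewrite (srt _ _ (ic_l1 S)) (srt _ _ (ic_u2 S)).
Qed.

Lemma ic_ups e : e \in fedges B -> dang_up B e -> e \in ups A e2.
Proof.
rewrite dang_upE (perm_mem ic_flatten_vlo) !inE => eB /norP[n2 /norP[n1 d]].
by move: eB; rewrite mem_filter dang_upE d n2 ic_mem_edges (negbTE n1).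
Qed.

Lemma ic_los e : e \in fedges B -> dang_lo B e -> e \in los A e3.
Proof.
rewrite dang_loE (perm_mem ic_flatten_vup) !inE => eB /norP[n2 /norP[n1 d]].
by move: eB; rewrite mem_filter dang_loE d n2 ic_mem_edges (negbTE n1).
Qed.

(** Both are opposite to the polarity of [e1]. This lets the polarities of the two reducts agree on
    the glued edge. *)
Lemma ic_polarity pol : polarity_ok B pol -> pol e2 = pol e3.
Proof.
move=> P; have := P _ ic_V1; have := P _ ic_V2; rewrite (ic_k1 S) (ic_k2 S).
move=> /(_ e3 e1) H3 /(_ e2 e1) H2; move: H2 H3.
rewrite !ic_vloV1 !ic_vupV2 !eqxx !orbT =>
  /(_ isT isT (elimN eqP ic_ne21)) + /(_ isT isT (elimN eqP ic_ne31)).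
by case: (pol e2) (pol e1) (pol e3) => [] [] [].
Qed.

Section Copy.
Variables (t ti : nat -> nat).
Hypothesis tK : {in fedges A, cancel t ti}.

Lemma copy_inj : {in fedges A &, injective t}.
Proof. exact: can_in_inj tK. Qed.

Lemma copy_mem_verts V : V \in fverts A -> V \in fverts B.
Proof. by rewrite ic_mem_verts !inE => ->; rewrite !orbT. Qed.

Lemma map_vertex_mem V e : V \in fverts A ->
  (e \in map t (vup V) -> ti e \in vup V) /\ (e \in map t (vlo V) -> ti e \in vlo V).
Proof.
move=> VA; have [_ /(_ V VA)[_ [_ sV]] _ _] := ic_wf.
by split=> /mapP[x xV ->]; rewrite tK //; apply: sV; rewrite mem_cat xV ?orbT.
Qed.

(** Renaming back embeds the copy in [B]; the added weakening goes to the interaction [V1], whose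
    lower edges include [e2]. *)
Lemma copy_weak_morph : flow_morph ti (add_weak (map_flow t A) (t e2)) B.
Proof.
split.
- by move=> _ _ /mapP[x xA ->] /mapP[y yA ->]; rewrite !tK // => ->.
- by move=> _ /mapP[x xA ->]; rewrite tK // ic_mem_edges xA orbT.
move=> V; rewrite inE => /predU1P[->|/mapP[W WA ->]].
  exists V1; split=> //; [exact: ic_V1 | | by left].
  by move=> e; rewrite inE => /eqP->; rewrite tK ?ic_e2A // ic_vloV1 eqxx.
exists W; split; [exact: copy_mem_verts | | | by right];
  by move=> e; case: (map_vertex_mem e WA).
Qed.

Lemma copy_coweak_morph : flow_morph ti (add_coweak (map_flow t A) (t e3)) B.
Proof.
split.
- by move=> _ _ /mapP[x xA ->] /mapP[y yA ->]; rewrite !tK // => ->.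
- by move=> _ /mapP[x xA ->]; rewrite tK // ic_mem_edges xA orbT.
move=> V; rewrite inE => /predU1P[->|/mapP[W WA ->]].
  exists V2; split=> //; [exact: ic_V2 | | by left].
  by move=> e; rewrite inE => /eqP->; rewrite tK ?ic_e3A // ic_vupV2 eqxx.
exists W; split; [exact: copy_mem_verts | | | by right];
  by move=> e; case: (map_vertex_mem e WA).
Qed.

Lemma copy_weak_wf : wf_flow (add_weak (map_flow t A) (t e2)).
Proof.
have e2A := ic_e2A; have wfA := ic_wf; have tinj := copy_inj.
apply: wf_add_weak; [exact: wf_map_flow | exact: map_f |].
by rewrite dang_up_map //; case: ic_dang_up.
Qed.

Lemma copy_coweak_wf : wf_flow (add_coweak (map_flow t A) (t e3)).
Proof.
have e3A := ic_e3A; have wfA := ic_wf; have tinj := copy_inj.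
apply: wf_add_coweak; [exact: wf_map_flow | exact: map_f |].
by rewrite dang_lo_map //; case: ic_dang_lo.
Qed.

Lemma copy_weak_ups e : e \in ups A e2 ->
  t e \in fedges (add_weak (map_flow t A) (t e2)) /\
  dang_up (add_weak (map_flow t A) (t e2)) (t e).
Proof.
rewrite mem_filter => /andP[/andP[d n] eA]; split; first exact: map_f.
rewrite /dang_up /= inE negb_or; apply/andP; split.
  by apply: contra n => /eqP/(copy_inj eA ic_e2A) ->.
by rewrite -/(dang_up (map_flow t A) (t e)) dang_up_map //; [exact: ic_wf | exact: copy_inj].
Qed.

Lemma copy_weak_los e : e \in fedges A -> dang_lo A e ->
  t e \in fedges (add_weak (map_flow t A) (t e2)) /\
  dang_lo (add_weak (map_flow t A) (t e2)) (t e).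
Proof.
move=> eA d; split; first exact: map_f.
by rewrite /dang_lo /= -/(dang_lo (map_flow t A) (t e)) dang_lo_map //; [exact: ic_wf | exact: copy_inj].
Qed.

Lemma copy_coweak_los e : e \in los A e3 ->
  t e \in fedges (add_coweak (map_flow t A) (t e3)) /\
  dang_lo (add_coweak (map_flow t A) (t e3)) (t e).
Proof.
rewrite mem_filter => /andP[/andP[d n] eA]; split; first exact: map_f.
rewrite /dang_lo /= inE negb_or; apply/andP; split.
  by apply: contra n => /eqP/(copy_inj eA ic_e3A) ->.
by rewrite -/(dang_lo (map_flow t A) (t e)) dang_lo_map //; [exact: ic_wf | exact: copy_inj].
Qed.

Lemma copy_coweak_ups e : e \in fedges A -> dang_up A e ->
  t e \in fedges (add_coweak (map_flow t A) (t e3)) /\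
  dang_up (add_coweak (map_flow t A) (t e3)) (t e).
Proof.
move=> eA d; split; first exact: map_f.
by rewrite /dang_up /= -/(dang_up (map_flow t A) (t e)) dang_up_map //; [exact: ic_wf | exact: copy_inj].
Qed.

End Copy.
End Split.

(** * Reducts *)

(** Upper dangling edges keep their names, whereas lower ones are renamed by [L]: an edge of [B]
    dangling at both ends yields two different edges of a glued flow. [rd_pol] starts from any
    polarity of [B], so that two reducts can be given matching ones. *)
Record reduct (B D : flow) (L : nat -> nat) (N : nat) : Prop := Reduct {
  rd_ex : ex_rel B D id L;
  rd_wf : wf_flow D;
  rd_ac : acyclic D;
  rd_conn : ~ connected D;
  rd_fresh : forall e, e \in fedges D -> e \in fedges B \/ N <= e;
  rd_up : forall e, e \in fedges B -> dang_up B e -> e \in fedges D /\ dang_up D e;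
  rd_lo : forall e, e \in fedges B -> dang_lo B e ->
    L e \in fedges D /\ dang_lo D (L e);
  rd_inj : forall e f, e \in fedges B -> dang_lo B e -> f \in fedges B -> dang_lo B f ->
    L e = L f -> e = f;
  rd_pol : forall pol, polarity_ok B pol -> exists pol',
    [/\ polarity_ok D pol',
        forall e, e \in fedges B -> dang_up B e -> pol' e = pol e &
        forall e, e \in fedges B -> dang_lo B e -> pol' (L e) = pol e];
  rd_reach : forall e f, e \in fedges B -> dang_up B e -> f \in fedges B -> dang_lo B f ->
    reach D e (L f) -> reach B e f \/ (to_coint B e /\ from_int B f);
  rd_from : forall f, f \in fedges B -> dang_lo B f -> from_int D (L f) -> from_int B f;
  rd_to : forall e, e \in fedges B -> dang_up B e -> to_coint D e -> to_coint B e
}.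

Lemma reach_to_coint F e f : reach F e f -> coint_edge F f -> to_coint F e.
Proof. by move=> r c; exists f. Qed.

Lemma reach_from_int F e f : int_edge F e -> reach F e f -> from_int F f.
Proof. by move=> i r; exists e. Qed.

Lemma edge_bound (s : seq nat) : exists M, forall e, e \in s -> e < M.
Proof.
exists (\max_(e <- s) e).+1 => e es; rewrite ltnS.
exact: (leq_bigmax_seq (F := id)) es isT.
Qed.

(** * The reduct of a flow from the reducts of its two copies *)

Section Step.
Variables (B A : flow) (e1 e2 e3 : nat) (V1 V2 : vertex) (N M : nat).
Hypotheses (wfB : wf_flow B) (clB : all_clean B).
Hypotheses (S : ic_split B A e1 e2 e3 V1 V2) (ex1 : extremal B e1).
Hypothesis BM : forall e, e \in fedges B -> e < M.
Variables (t h ti hi : nat -> nat) (D1 D2 : flow) (L1 L2 : nat -> nat) (K N2 : nat).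
Hypotheses (tK : {in fedges A, cancel t ti}) (hK : {in fedges A, cancel h hi}).
Hypothesis tM : forall e, e \in fedges A -> maxn N M <= t e.
Local Notation B1 := (add_weak (map_flow t A) (t e2)).
Local Notation B2 := (add_coweak (map_flow h A) (h e3)).
Hypotheses (R1 : reduct B1 D1 L1 (maxn N M)) (R2 : reduct B2 D2 L2 N2).
Hypothesis D1M : forall e, e \in fedges D1 -> e < N2.
Hypothesis NM2 : maxn N M <= N2.
Hypothesis hM : forall e, e \in fedges A -> e != e2 -> N2 <= h e.
(** The second copy names [e2] after the edge that stands for [e3] in [D1]; as upper edges keep
    their names in a reduct, the two edges to be glued already coincide. *)
Hypothesis hg : h e2 = L1 (t e3).
Hypothesis D2M : forall e, e \in fedges D2 -> e < K.
Hypothesis NK : N2 <= K.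

Let L e := e + K.
Let g := L1 (t e3).
Let wfA := ic_wf wfB S.
Let e2A := ic_e2A wfB S.
Let e3A := ic_e3A wfB S.
Let d2 : dang_up A e2 := (ic_dang_up wfB S).1.
Let d3 : dang_lo A e3 := (ic_dang_lo wfB S).1.
Let m1 := copy_weak_morph wfB S tK.
Let m2 := copy_coweak_morph wfB S hK.

Let g_in1 : g \in fedges D1 /\ dang_lo D1 g.
Proof. by have [x y] := copy_weak_los wfB S tK e3A d3; apply: rd_lo R1 _ x y. Qed.

Let g_in2 : g \in fedges D2 /\ dang_up D2 g.
Proof.
have [x y] := copy_coweak_ups wfB S hK e2A d2; rewrite /g -hg.
exact: rd_up R2 _ x y.
Qed.

Let ups_A e : e \in ups A e2 -> [/\ e \in fedges A, dang_up A e & e != e2].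
Proof. by rewrite mem_filter => /andP[/andP[]]. Qed.

Let los_A e : e \in los A e3 -> [/\ e \in fedges A, dang_lo A e & e != e3].
Proof. by rewrite mem_filter => /andP[/andP[]]. Qed.

Let AB e : e \in fedges A -> e \in fedges B.
Proof. by rewrite (ic_mem_edges S) => ->; rewrite orbT. Qed.

Let D1_big e : e \in fedges D1 -> maxn N M <= e.
Proof. by move=> /(rd_fresh R1)[/mapP[x xA ->]|//]; apply: tM. Qed.

Let D2_big e : e \in fedges D2 -> e <> g -> N2 <= e.
Proof.
move=> /(rd_fresh R2)[/mapP[x xA ->] ng|//]; apply: hM => //.
by apply/eqP=> x2; apply: ng; rewrite x2 hg.
Qed.

Let D12_big e : e \in fedges D1 ++ fedges D2 -> maxn N M <= e < K.
Proof.
rewrite mem_cat => /orP[] eD.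
  by rewrite D1_big // (leq_trans (D1M eD)).
rewrite D2M // andbT; case: (eqVneq e g) => [->|/eqP ne].
  by apply: D1_big; case: g_in1.
exact: leq_trans NM2 (D2_big eD ne).
Qed.

Let NMK : maxn N M <= K := leq_trans NM2 NK.
Let MK : M <= K := leq_trans (leq_maxr N M) NMK.
Let NK' : N <= K := leq_trans (leq_maxl N M) NMK.

(** Disjointness comes from ranges of names: those of [B] lie below [M], those of [D1] from
    [maxn N M] up to below [N2], those of [D2] other than [g] from [N2] up to below [K], and the new
    lower names from [K] on. *)
Lemma step_glueable : glueable D1 D2 g (ups A e2) (los A e3) id L t h (L1 \o t) (L2 \o h).
Proof.
have [uA _ _ _] := wfA; have [gD1 lg] := g_in1; have [gD2 ug] := g_in2.
have tinj := copy_inj tK; have hinj := copy_inj hK.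
have wups := copy_weak_ups wfB S tK; have wlos := copy_weak_los wfB S tK.
have cups := copy_coweak_ups wfB S hK; have clos := copy_coweak_los wfB S hK.
split=> //.
- exact: rd_wf R1.
- exact: rd_wf R2.
- move=> e x1 x2; apply/eqP/negPn/negP => /eqP ne.
  by have := leq_trans (D1M x1) (D2_big x2 ne); rewrite ltnn.
- exact: filter_uniq.
- exact: filter_uniq.
- by move=> e /wups[x y]; apply: rd_up R1 _ x y.
- move=> e eU; have [eA de ne] := ups_A eU; have [x y] := cups _ eA de.
  have [z w] := rd_up R2 x y; split=> //.
  by rewrite /g -hg => /(hinj _ _ eA e2A) /eqP; rewrite (negbTE ne).
- move=> e eU; have [eA de ne] := los_A eU; have [x y] := wlos _ eA de.
  have [z w] := rd_lo R1 x y; split=> // eg.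
  have [x3 y3] := wlos _ e3A d3; have := rd_inj R1 x y x3 y3 eg.
  by move=> /(tinj _ _ eA e3A) /eqP; rewrite (negbTE ne).
- by move=> e /clos[x y]; apply: rd_lo R2 _ x y.
- by move=> e f /ups_A[x _ _] /ups_A[y _ _]; apply: tinj.
- by move=> e f /ups_A[x _ _] /ups_A[y _ _]; apply: hinj.
- move=> e f /los_A[x dx _] /los_A[y dy _].
  have [p q] := wlos _ x dx; have [p' q'] := wlos _ y dy.
  by move=> /(rd_inj R1 p q p' q'); apply: tinj.
- move=> e f el fl; have [x _ _] := los_A el; have [y _ _] := los_A fl.
  have [p q] := clos _ el; have [p' q'] := clos _ fl.
  by move=> /(rd_inj R2 p q p' q'); apply: hinj.
- by move=> e f _ _ /addIn.
- move=> e f /ups_A[/AB/BM eM _ _] _ ef.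
  by have := leq_trans eM MK; rewrite [e]ef ltnNge leq_addl.
- move=> e /ups_A[/AB/BM eM _ _]; apply/negP=> /D12_big/andP[+ _].
  by rewrite geq_max => /andP[_]; rewrite leqNgt eM.
- by move=> e _; apply/negP=> /D12_big/andP[_]; rewrite ltnNge leq_addl.
Qed.

Let GD := step_glueable.

Lemma step_reduct : exists D L, reduct B D L N.
Proof.
have [gD1 lg] := g_in1; have [gD2 ug] := g_in2.
have tinj := copy_inj tK; have hinj := copy_inj hK.
have wups := copy_weak_ups wfB S tK; have wlos := copy_weak_los wfB S tK.
have cups := copy_coweak_ups wfB S hK; have clos := copy_coweak_los wfB S hK.
have [w1 w2] := wlos _ e3A d3; have [c1 c2] := cups _ e2A d2.
have i2 : int_edge B e2.
  by apply/hasP; exists V1; rewrite ?(ic_V1 S) // (ic_k1 S) (ic_vloV1 S) !eqxx.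
have i3 : coint_edge B e3.
  by apply/hasP; exists V2; rewrite ?(ic_V2 S) // (ic_k2 S) (ic_vupV2 S) !eqxx.
(* The only place where extremality of [e1] excludes a connection across [g]. *)
have sep := extremal_separates wfB clB (ic_V1 S) (ic_k1 S) _ _ _ (ic_V2 S) (ic_k2 S) _ _ _ ex1.
have {}sep : from_int B e3 -> to_coint B e2 -> False.
  apply: sep; rewrite ?(ic_vloV1 S) ?(ic_vupV2 S) ?eqxx ?orbT //; apply/eqP.
    exact: ic_ne21 wfB S.
  exact: ic_ne31 wfB S.
have reach1 e f : e \in ups A e2 -> f \in fedges A -> dang_lo A f ->
    reach D1 (t e) (L1 (t f)) -> reach B e f \/ (to_coint B e /\ from_int B f).
  move=> eU fA df r; have [x y] := wups _ eU; have [x' y'] := wlos _ fA df.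
  have [eA _ _] := ups_A eU.
  case: (rd_reach R1 x y x' y' r) => [/(morph_reach m1)|[/(morph_to_coint m1) + /(morph_from_int m1)]];
    rewrite !tK //; by [left|right].
have reach2 e f : e \in fedges A -> dang_up A e -> f \in los A e3 ->
    reach D2 (h e) (L2 (h f)) -> reach B e f \/ (to_coint B e /\ from_int B f).
  move=> eA de fL r; have [x y] := cups _ eA de; have [x' y'] := clos _ fL.
  have [fA _ _] := los_A fL.
  case: (rd_reach R2 x y x' y' r) => [/(morph_reach m2)|[/(morph_to_coint m2) + /(morph_from_int m2)]];
    rewrite !hK //; by [left|right].
(* In [B] the edge [e3] meets a cointeraction, so both alternatives for a path towards [g] put [e]
   above one. Dually below, as [e2] meets an interaction. *)
have to1 e : e \in ups A e2 -> reach D1 (t e) g -> to_coint B e.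
  by move=> eU /(reach1 _ _ eU e3A d3)[/reach_to_coint|[]//]; apply.
have from2 f : f \in los A e3 -> reach D2 g (L2 (h f)) -> from_int B f.
  by rewrite /g -hg => fL /(reach2 _ _ e2A d2 fL)[/(reach_from_int i2)|[]].
have from1 f : f \in fedges A -> dang_lo A f -> from_int D1 (L1 (t f)) -> from_int B f.
  move=> fA df; have [x y] := wlos _ fA df.
  by move=> /(rd_from R1 x y)/(morph_from_int m1); rewrite tK.
have to2 e : e \in fedges A -> dang_up A e -> to_coint D2 (h e) -> to_coint B e.
  move=> eA de; have [x y] := cups _ eA de.
  by move=> /(rd_to R2 x y)/(morph_to_coint m2); rewrite hK.
exists (glued D1 D2 g (ups A e2) (los A e3) id L t h (L1 \o t) (L2 \o h)), L.
have Bups := ic_ups S; have Blos := ic_los S.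
split.
- apply: (@ex_step B A e1 e2 e3 t h D1 id L1 D2 id L2 id L) => //.
  + exact: ic_flow_equiv S.
  + by case/andP: (ic_edges_uniq wfB S).
  + exact: ic_23 S.
  + exact: rd_ex R1.
  + exact: rd_ex R2.
  + exact: gl_share GD.
  + exact: gl_iL GD.
  + by move=> e f eU fL; apply/eqP/(gl_UL GD).
  + exact: gl_UD GD.
  + exact: gl_LD GD.
- exact: wf_glued GD.
- exact: (acyclic_glued GD (rd_ac R1) (rd_ac R2)).
- case/(connected_glued GD) => [/(rd_conn R1)|/(rd_conn R2)|[fr to]] //.
  (* A connection across [g] would put an interaction above [e3] and a cointeraction below [e2] in
     [B]. *)
  by apply: sep; [exact: from1 fr | apply: to2; rewrite ?hg].
- move=> e; rewrite /= !mem_cat => /or4P[].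
  + by move=> /mapP[x /ups_A[xA _ _] ->]; left; apply: AB.
  + by move=> /mapP[x _ ->]; right; apply: leq_trans NK' (leq_addl _ _).
  + by move=> /D1_big H; right; apply: leq_trans H; apply: leq_maxl.
  + rewrite mem_filter => /andP[/eqP ne /D2_big/(_ ne) H]; right.
    by apply: leq_trans H; apply: leq_trans NM2; apply: leq_maxl.
- move=> e eB /(Bups _ eB) eU; split;
    first exact: (@mem_gluedU D1 D2 g _ (los A e3) id L t h _ _ e eU).
  exact: (dang_up_glued GD eU).
- move=> e eB /(Blos _ eB) eL; split;
    first exact: (@mem_gluedL D1 D2 g (ups A e2) _ id L t h _ _ e eL).
  exact: (dang_lo_glued GD eL).
- by move=> e f _ _ _ _ /addIn.
- move=> pol P; have := ic_polarity wfB S P => p23.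
  have [p1 [P1 U1 Lo1]] := rd_pol R1 (morph_polarity (copy_weak_wf wfB S tK) m1 P).
  have [p2 [P2 U2 Lo2]] := rd_pol R2 (morph_polarity (copy_coweak_wf wfB S hK) m2 P).
  have [|e|e|q [Q QU QL]] := polarity_glued GD (pU := pol) (pL := pol) P1 P2.
  (* Agreement on [g], which stands for [e3] in [D1] and for [e2] in [D2]. *)
  + by rewrite /g Lo1 //= tK // -hg U2 //= hK.
  + by move=> eU; have [eA de _] := ups_A eU; have [x y] := wups _ eU;
      have [x' y'] := cups _ eA de; rewrite U1 // U2 //= tK ?hK.
  + by move=> eL; have [eA de _] := los_A eL; have [x y] := wlos _ eA de;
      have [x' y'] := clos _ eL; rewrite Lo1 // Lo2 //= tK ?hK.
  by exists q; split=> // e eB; [move/(Bups _ eB)/QU | move/(Blos _ eB)/QL].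
- move=> e f eB /(Bups _ eB) eU fB /(Blos _ fB) fL.
  have [eA de _] := ups_A eU; have [fA df _] := los_A fL.
  case/(reach_gluedUL GD eU fL) => [|[eg gf]|]; [exact: reach1| |exact: reach2].
  (* A path through [g] need not come from a path of [B]; it accounts for the second alternative of
     [rd_reach]. *)
  by right; split; [exact: to1 | exact: from2].
- move=> f fB /(Blos _ fB) fL; have [fA df _] := los_A fL.
  case/(from_int_gluedL GD fL) => [|[_]|]; [exact: from1|exact: from2|].
  have [x y] := clos _ fL.
  by move=> /(rd_from R2 x y)/(morph_from_int m2); rewrite hK.
- move=> e eB /(Bups _ eB) eU; have [eA de _] := ups_A eU.
  case/(to_coint_gluedU GD eU) => [|[eg _]|]; [|exact: to1|exact: to2].
  have [x y] := wups _ eU.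
  by move=> /(rd_to R1 x y)/(morph_to_coint m1); rewrite tK.
Qed.

End Step.

(** * Existence of reducts by induction *)

Lemma no_extremal_not_connected B : wf_flow B -> cycle_free B -> all_clean B ->
  (forall e, ~ extremal B e) -> ~ connected B.
Proof.
move=> wf cf cl nex [e ie [f cof r]].
have ef := connection_simple wf cl ie r cof.
have [x] : exists x, extremal B x; last exact: nex.
apply: (extremal_exists wf cf cl (e := e)).
by apply/(simple_edgeP _ wf); rewrite ie ef.
Qed.

(** Induction on the number of vertices: each copy loses an interaction and a cointeraction and
    gains one vertex. The bound [N] stays general because the two recursive calls need different
    ones. *)
Lemma reduct_exists B N : wf_flow B -> acyclic B -> cycle_free B -> all_clean B ->
  exists D L, reduct B D L N.
Proof.
have [n] := ubnP (size (fverts B)); elim: n B N => // n IH B N szB wfB acB cfB clB.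
case: (classic (exists e, extremal B e)) => [[e1 ex1]|nex]; last first.
  have nex' e : ~ extremal B e by move=> h; apply: nex; exists e.
  exists B, id; split=> //; first exact: ex_base.
  - exact: no_extremal_not_connected.
  - by left.
  - by move=> pol P; exists pol.
  - by left.
have : int_edge B e1 && coint_edge B e1.
  by apply/simple_edgeP => //; case: ex1 => s [k [_ [_ [_ [_ []]]]]].
move=> /andP[i1 c1].
have [A [e2 [e3 [V1 [V2 S]]]]] := ic_split_exists wfB cfB i1 c1.
have [M BM] := edge_bound (fedges B).
have szA : (size (fverts A)).+1 < n.
  by move: szB; rewrite (perm_size (ic_verts S)) /= ltnS.
pose t e := e + maxn N M; pose ti e := e - maxn N M.
have tK : {in fedges A, cancel t ti} by move=> e _; rewrite /t /ti addnK.
have mt := copy_weak_morph wfB S tK; have wft := copy_weak_wf wfB S tK.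
have [|||||D1 [L1 R1]] := IH (add_weak (map_flow t A) (t e2)) (maxn N M); rewrite /= ?size_map //.
- exact: morph_acyclic mt acB.
- exact: morph_cycle_free mt cfB.
- exact: morph_all_clean mt clB.
have [M1 D1M] := edge_bound (fedges D1).
(* The second copy is built after the first reduct, since its names must avoid those of [D1] and
   reuse the one of the glued edge. *)
pose N2 := maxn M1 (maxn N M).
pose h e := if e == e2 then L1 (t e3) else e + N2.
pose hi e := if e == L1 (t e3) then e2 else e - N2.
have g1 : L1 (t e3) < N2.
  have [x y] := copy_weak_los wfB S tK (ic_e3A wfB S) (ic_dang_lo wfB S).1.
  by have [/D1M] := rd_lo R1 x y; rewrite /N2; lia.
have hK : {in fedges A, cancel h hi}.
  move=> e _; rewrite /h /hi; case: (eqVneq e e2) => [->|_]; first by rewrite eqxx.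
  (* Shifted names are at least [N2] and the glued name is below it, so [hi] can tell them apart. *)
  by rewrite addnK; case: eqP => // eg; move: g1; rewrite -eg; lia.
have mh := copy_coweak_morph wfB S hK; have wfh := copy_coweak_wf wfB S hK.
have [|||||D2 [L2 R2]] := IH (add_coweak (map_flow h A) (h e3)) N2; rewrite /= ?size_map //.
- exact: morph_acyclic mh acB.
- exact: morph_cycle_free mh cfB.
- exact: morph_all_clean mh clB.
have [M2 D2M] := edge_bound (fedges D2).
apply: (step_reduct wfB clB S ex1 BM tK hK _ R1 R2 (K := maxn M2 N2)).
- by move=> e _; rewrite /t; lia.
- by move=> e /D1M; rewrite /N2; lia.
- by rewrite /N2; lia.
- by move=> e _ /negbTE ne; rewrite /h ne; lia.
- by rewrite /h eqxx.
- by move=> e /D2M; lia.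
- by lia.
Qed.

Theorem theorem5p12 (B : flow) :
  atomic_flow B -> cycle_free B ->
  (forall s, ai_path B s -> clean_path B s) ->
  exists C : flow, atomic_flow C /\ no_ai_connection C /\ ex_red B C.
Proof.
move=> /atomic_flowP[wf ac [pol P]] cf cl.
(* At the outermost level no names outside [B] have to be avoided, hence the bound 0. *)
have [C [L R]] := reduct_exists 0 wf ac cf cl.
have [polC [PC _ _]] := rd_pol R P.
exists C; split; last split.
- apply/atomic_flowP; split; [exact: rd_wf R | exact: rd_ac R |].
  by exists polC.
- by apply/no_connectedP; [exact: rd_wf R | exact: rd_conn R].
- by exists id, L; apply: rd_ex R.
Qed.
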